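(* Let $\mathfrak{g}$ be a simple Lie algebra over $\mathbb{R}$ that is split, i.e. it has a Cartan subalgebra $\mathfrak{h}$ such that $\mathfrak{g}$ is the direct sum of $\mathfrak{h}$ and the one-dimensional root spaces $\mathfrak{g}^{\alpha}$, $\alpha\in\Delta$, where $\Delta\subset\mathfrak{h}^*$ is the root system of $(\mathfrak{g},\mathfrak{h})$. Let $\Delta_+$ be a system of positive roots in $\Delta$, let $\mathfrak{b}=\mathfrak{h}\oplus\bigoplus_{\alpha\in\Delta_+}\mathfrak{g}^{\alpha}$ be the corresponding Borel subalgebra, and let $\mathbf{i}(\mathfrak{b})$ be the index of the Lie algebra $\mathfrak{b}$. Then: \begin{enumerate} \item if $\mathfrak{g}$ is of type $A_r$, then $\mathbf{i}(\mathfrak{b})=\left[\frac{r}{2}\right]$, where $[\cdot]$ denotes the integer part; \item if $\mathfrak{g}$ is of type $B_r$, $C_r$, $D_{2r}$, $E_8$, $E_7$, $F_4$ or $G_2$, then $\mathbf{i}(\mathfrak{b})=0$; \item if $\mathfrak{g}$ is of type $D_{2r+1}$, then $\mathbf{i}(\mathfrak{b})=1$; \item if $\mathfrak{g}$ is of type $E_6$, then $\mathbf{i}(\mathfrak{b})=2$. \end{enumerate}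
   Context: For a finite-dimensional Lie algebra $\mathfrak{a}$ over $\mathbb{R}$ and a linear form $f\in\mathfrak{a}^*$, let $B_f$ be the antisymmetric bilinear form on $\mathfrak{a}$ defined by $B_f(X,Y)=f([X,Y])$, and set $\mathbf{i}(B_f)=\dim\ker B_f$, where $\ker B_f=\{X\in\mathfrak{a}: f([X,Y])=0\text{ for all }Y\in\mathfrak{a}\}$. The index of $\mathfrak{a}$ is $\mathbf{i}(\mathfrak{a})=\min_{f\in\mathfrak{a}^*}\mathbf{i}(B_f)$. The type of $\mathfrak{g}$ is the Cartan–Killing type of its irreducible root system $\Delta$; the subscript is the rank. *)

(* Defs.v *)
(* MathComp, with the real numbers given by a realType of MathComp-Analysis. *)
From HB Require Import structures.
From mathcomp Require Import all_boot all_order all_algebra.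
From mathcomp Require Import boolp reals.

Set Implicit Arguments.
Unset Strict Implicit.
Unset Printing Implicit Defensive.

Import Order.TTheory GRing.Theory Num.Theory.
Local Open Scope ring_scope.

Section LieAlgebra.
Variables (K : fieldType) (L : vectType K) (br : L -> L -> L).

Record lie_bracket : Prop := LieBracket {
  lie_linearl : forall y, linear (fun x => br x y);
  lie_linearr : forall x, linear (br x);
  lie_alt : forall x, br x x = 0;
  lie_jacobi : forall x y z, br x (br y z) + br y (br z x) + br z (br x y) = 0
}.

Definition subalgebra (U : {vspace L}) : Prop :=
  {in U &, forall x y, br x y \in U}.

Definition lie_ideal (U : {vspace L}) : Prop :=
  forall x y, y \in U -> br x y \in U.

Definition lie_simple : Prop :=
  (exists x y, br x y <> 0) /\
  (forall U : {vspace L}, lie_ideal U -> U = 0%VS \/ U = fullv).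

(* [U, V], the span of the brackets of elements of U with elements of V *)
Definition liev (U V : {vspace L}) : {vspace L} :=
  <<[seq br x y | x <- vbasis U, y <- vbasis V]>>%VS.

Definition lie_nilpotent (U : {vspace L}) : Prop :=
  exists n, iter n (liev U) U = 0%VS.

Definition cartan_subalgebra (h : {vspace L}) : Prop :=
  [/\ subalgebra h, lie_nilpotent h
    & forall x, {in h, forall y, br x y \in h} -> x \in h].

Definition ad (x : L) : 'End(L) := linfun (br x).

(* ker B_f, the kernel of x |-> B_f(x, .), where B_f(x, y) = f [x, y] *)
Definition form_ker (f : 'Hom(L, K^o)) : {vspace L} :=
  lker (linfun (fun x => linfun (fun y => f (br x y) : K^o))).

Lemma form_kerP (f : 'Hom(L, K^o)) x : lie_bracket ->
  x \in form_ker f <-> forall y, f (br x y) = 0.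
Proof.
move=> [lin_l lin_r _ _].
pose Bl u : {linear L -> K^o} :=
  HB.pack (fun y => f (br u y) : K^o)
    (GRing.isLinear.Build _ _ _ _ (fun y => f (br u y) : K^o)
       (fun c y z => etrans (congr1 f (lin_r u c y z)) (linearP f c _ _))).
have BlE u y : linfun (fun z => f (br u z) : K^o) y = f (br u y).
  exact: (lfunE (Bl u)).
have lin : linear (fun u => linfun (fun z => f (br u z) : K^o)).
  move=> c u v; apply/lfunP => y.
  by rewrite add_lfunE scale_lfunE !BlE (lin_l y c u v) linearP.
pose B : {linear L -> 'Hom(L, K^o)} :=
  HB.pack (fun u => linfun (fun z => f (br u z) : K^o))
    (GRing.isLinear.Build _ _ _ _
       (fun u => linfun (fun z => f (br u z) : K^o)) lin).
rewrite memv_ker (lfunE B) /=; split.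
  by move=> /eqP B0 y; rewrite -BlE B0 zero_lfunE.
by move=> fx0; apply/eqP/lfunP => y; rewrite BlE fx0 zero_lfunE.
Qed.

Fact form_ker_dim_exists :
  exists n, `[< exists f : 'Hom(L, K^o), \dim (form_ker f) = n >].
Proof. by exists (\dim (form_ker 0)); apply/asboolP; exists 0. Qed.

Definition lie_index : nat := ex_minn form_ker_dim_exists.

Definition dual (h : {vspace L}) := 'Hom(subvs_of h, K^o).

Definition rootspace (h : {vspace L}) (a : dual h) : {vspace L} :=
  (\bigcap_(i < \dim h)
     lker (ad (vbasis h)`_i - a (vsproj h (vbasis h)`_i) *: \1%VF))%VS.

Lemma rootspaceP (h : {vspace L}) (a : dual h) x : lie_bracket ->
  x \in rootspace a <-> forall y : subvs_of h, br (vsval y) x = a y *: x.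
Proof.
move=> [lin_l lin_r _ _].
have adE u y : ad u y = br u y.
  pose A : {linear L -> L} :=
    HB.pack (br u) (GRing.isLinear.Build _ _ _ _ (br u) (lin_r u)).
  exact: (lfunE A).
pose Br : {linear L -> L} := HB.pack (fun u => br u x)
  (GRing.isLinear.Build _ _ _ _ (fun u => br u x) (lin_l x)).
have eigP u c : (x \in lker (ad u - c *: \1%VF)) = (br u x == c *: x).
  rewrite memv_ker add_lfunE opp_lfunE scale_lfunE id_lfunE adE.
  by rewrite subr_eq0.
split=> [|H]; last first.
  rewrite memvE; apply/subv_bigcapP => i _; rewrite -memvE eigP.
  by rewrite -H vsprojK ?vbasis_mem ?memt_nth.
rewrite memvE => /subv_bigcapP H y.
have yE := coord_vbasis (subvsP y).
have aE : a y = \sum_(i < \dim h)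
    coord (vbasis h) i (vsval y) *: a (vsproj h (vbasis h)`_i).
  by rewrite -{1}(vsvalK y) {1}yE !linear_sum; apply: eq_bigr => i _;
     rewrite !linearZ.
rewrite -[br _ x]/(Br (vsval y)) [in LHS]yE linear_sum aE scaler_suml.
apply: eq_bigr => i _; rewrite linearZ -scalerA; congr (_ *: _).
by apply/eqP; rewrite -eigP memvE; apply: H.
Qed.

Definition root_system (h : {vspace L}) (Delta : seq (dual h)) : Prop :=
  uniq Delta /\
  forall a : dual h, a \in Delta <-> a != 0 /\ rootspace a != 0%VS.

Definition split_wrt (h : {vspace L}) (Delta : seq (dual h)) : Prop :=
  [/\ (h + \sum_(i < size Delta) rootspace (Delta`_i : dual h))%VS = fullv,
      directv (h + \sum_(i < size Delta) rootspace (Delta`_i : dual h))%VS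
    & {in Delta, forall a : dual h, \dim (rootspace a) = 1%N}].

Definition borel (h : {vspace L}) (Delta_plus : seq (dual h)) : {vspace L} :=
  (h + \sum_(a <- Delta_plus) rootspace a)%VS.

End LieAlgebra.

(* The bracket of the Lie algebra U; vsproj is the identity on U, so this is
   the restriction of br as soon as U is a subalgebra. *)
Definition sub_bracket (K : fieldType) (L : vectType K) (br : L -> L -> L)
    (U : {vspace L}) (x y : subvs_of U) : subvs_of U :=
  vsproj U (br (vsval x) (vsval y)).

(* The roots that are positive on some H0 in h on which no root vanishes,
   i.e. those on one side of a hyperplane of h^* avoiding the roots. *)
Definition positive_system (R : realFieldType) (L : vectType R)
    (h : {vspace L}) (Delta Delta_plus : seq (dual h)) : Prop :=
  exists H0 : subvs_of h,
    {in Delta, forall a : dual h, a H0 != 0} /\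
    forall a : dual h, (a \in Delta_plus) = (a \in Delta) && (0 < (a H0 : R)).

Inductive cartan_type :=
  | typeA of nat | typeB of nat | typeC of nat | typeD of nat
  | typeE6 | typeE7 | typeE8 | typeF4 | typeG2.

(* The standard root systems as sets of vectors of R^n; n exceeds the rank for
   A, E6, E7 and G2. The rank r is unrestricted: this allows the duplicates
   B_1 = C_1 = A_1, C_2 = B_2 and D_3 = A_3, whereas A_0, B_0, C_0, D_0, D_1
   and D_2 are not root systems of simple Lie algebras. *)
Section StandardRootSystems.
Variable R : numFieldType.

Local Notation e i := (delta_mx 0 i : 'rV[R]_(_)).
Local Notation sg s := ((-1) ^+ nat_of_bool s : R).

Definition root_short n (v : 'rV[R]_n) : Prop :=
  exists i, exists s : bool, v = sg s *: e i.

Definition rootA n (v : 'rV[R]_n) : Prop :=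
  exists i j, i != j /\ v = e i - e j.

Definition rootD n (v : 'rV[R]_n) : Prop :=
  exists i j, exists s t : bool, i != j /\ v = sg s *: e i + sg t *: e j.

Definition rootB n (v : 'rV[R]_n) : Prop := root_short v \/ rootD v.

Definition rootC n (v : 'rV[R]_n) : Prop :=
  (exists i, exists s : bool, v = (2 * sg s) *: e i) \/ rootD v.

Definition half_spin n (s : 'I_n -> bool) : 'rV[R]_n :=
  2^-1 *: \sum_i sg (s i) *: e i.

Definition rootF4 (v : 'rV[R]_4) : Prop :=
  rootB v \/ exists s : 'I_4 -> bool, v = half_spin s.

Definition rootE8 (v : 'rV[R]_8) : Prop :=
  rootD v \/ exists s : 'I_8 -> bool, ~~ odd (\sum_i s i)%N /\ v = half_spin s.

(* With coordinates x_1, ..., x_8: E7 is the part of E8 with x_7 = - x_8,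
   and E6 the part with x_6 = x_7 = - x_8. *)
Definition rootE7 (v : 'rV[R]_8) : Prop :=
  rootE8 v /\ v 0 (inord 6) = - v 0 (inord 7).

Definition rootE6 (v : 'rV[R]_8) : Prop :=
  rootE7 v /\ v 0 (inord 5) = v 0 (inord 6).

Definition rootG2 (v : 'rV[R]_3) : Prop :=
  rootA v \/
  exists i j k, exists s : bool,
    uniq [:: i; j; k] /\ v = sg s *: (2 *: e i - e j - e k).

Definition ambient_dim (t : cartan_type) : nat :=
  match t with
  | typeA r => r.+1
  | typeB r | typeC r | typeD r => r
  | typeE6 | typeE7 | typeE8 => 8
  | typeF4 => 4
  | typeG2 => 3
  end.

Definition std_root (t : cartan_type) : 'rV[R]_(ambient_dim t) -> Prop :=
  match t return 'rV[R]_(ambient_dim t) -> Prop with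
  | typeA r => @rootA r.+1
  | typeB r => @rootB r
  | typeC r => @rootC r
  | typeD r => @rootD r
  | typeE6 => rootE6
  | typeE7 => rootE7
  | typeE8 => rootE8
  | typeF4 => rootF4
  | typeG2 => rootG2
  end.

(* Delta is isomorphic, as a root system, to the standard one of type t. The
   roots of a simple Lie algebra span h^*, so the injective linear map phi is
   an isomorphism of h^* onto the span of the standard root system. *)
Definition of_type (L : vectType R) (h : {vspace L}) (Delta : seq (dual h))
    (t : cartan_type) : Prop :=
  exists phi : 'Hom('Hom(subvs_of h, R^o), 'rV[R]_(ambient_dim t)),
    lker phi = 0%VS /\
    forall v, std_root v <-> exists2 a, a \in Delta & v = phi a.

End StandardRootSystems.

(* Main.v *)
Require Import Defs.
From HB Require Import structures.
From mathcomp Require Import all_boot all_order all_algebra.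
From mathcomp Require Import reals.
From mathcomp Require Import zify ring lra.
Import Order.TTheory GRing.Theory Num.Theory.
Local Open Scope ring_scope.
Set Implicit Arguments.
Unset Strict Implicit.
Unset Printing Implicit Defensive.

(** The proof follows Kostant's cascade. Let b be the highest root of a set of
    positive roots, t its coroot, and e a root vector of b. The grading of the
    Borel subalgebra by ad t has degrees 0, 1 and 2; degree 2 is the line <e>,
    and in degree 1 the bracket with values in <e> is a symplectic form, since
    the roots of degree 1 come in pairs of sum b. Thus degrees 1 and 2 form a
    Heisenberg ideal. If f does not vanish on e, elimination of <e>, <t> and of
    the degree 1 part from B_f leaves a form B_f' on the subalgebra spanned by
    the kernel of b in h and by the root spaces of the roots orthogonal to b, and
    the kernel keeps its dimension; forms vanishing on e are limits of others,
    and the dimension of the kernel is upper semicontinuous. Hence the index is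
    the same for both algebras (has_index_reduction). Iterating until no root is
    left, one gets a commutative algebra, and the index of the Borel subalgebra
    is the rank minus the length of the cascade (borel_index_cascade).

    The only input from the theory of semisimple algebras is that the bracket
    of two root vectors is nonzero when the sum of their roots is a root
    (root_bracket_neq0). For a split simple algebra over an ordered field this
    is elementary: the roots separate h, so the Killing form is positive definite
    on h, hence nondegenerate by simplicity, every root has an sl2-triple, and the
    claim follows from the representation theory of sl2.

    It remains to find cascades for all positive systems of the standard root
    systems. In the classical types they are written down after ordering the
    coordinates of a vector that defines the positive roots, and have
    (r + 1) / 2, rounded down, members for A_r, r for B_r and C_r, and the
    largest even number up to r for D_r. In the exceptional types any chamber is
    moved by simple reflections to a reference chamber (chamber_cascade), where
    the cascade is checked by computation; the lengths are 2 for G2, 4 for F4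
    and E6, 7 for E7 and 8 for E8. *)

(** * Semicontinuity of the kernel of a linear map *)

Lemma exists_nonroot (F : numFieldType) (p : {poly F}) :
  p != 0 -> exists2 u, u != 0 & p.[u] != 0.
Proof.
move=> p0; pose s := [seq (i.+1)%:R : F | i <- iota 0 (size p)].
have us : uniq s.
  rewrite map_inj_uniq ?iota_uniq // => i j /eqP.
  by rewrite eqr_nat eqSS => /eqP.
have [/allP all_root|/allPn[u /mapP[i _ ->] pu]] := boolP (all (root p) s).
  have := max_poly_roots p0 (introT allP all_root) us.
  by rewrite size_map size_iota ltnn.
by exists i.+1%:R; rewrite ?pnatr_eq0.
Qed.

(** The rank of a linear map can only drop at special points of a line. If A
    is injective on C, the matrix of A + s B between C and its image under A is
    1 + s N, which is singular only when - 1 / s is an eigenvalue of N; some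
    s outside this finite set keeps A + s B injective on C. *)
Lemma lker_dim_perturb (F : numFieldType) (V W : vectType F)
    (A B : 'Hom(V, W)) n :
  (forall s, s != 0 -> (n <= \dim (lker (A + s *: B)%R))%N) ->
  (n <= \dim (lker A))%N.
Proof.
pose C := ((lker A)^C)%VS; pose c := vbasis C.
have capC : (C :&: lker A)%VS = 0%VS by rewrite capvC capv_compl.
have freeX : free (map_tuple A c).
  exact: basis_free (limg_basis_of capC (vbasisP C)).
pose N := \matrix_(i < \dim C, j < \dim C) coord (map_tuple A c) j (B c`_i).
have [|u u0 nzu] := @exists_nonroot F (char_poly (- N)).
  exact: monic_neq0 (char_poly_monic _).
move=> /(_ u^-1); rewrite invr_eq0 => /(_ u0) le_n.
have unitN : u%:M + N \in unitmx.
  rewrite unitmxE unitfE; move: nzu.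
  rewrite -[_.[u]]/(horner_eval u _) -det_map_mx; congr (\det _ != 0).
  apply/matrixP => i j; rewrite !mxE.
  by rewrite -[LHS]/(_.[u]) hornerD hornerN hornerC opprK hornerMn hornerX.
pose D := A + u^-1 *: B.
have freeD : free (map_tuple D c).
  apply/freeP => k sum0.
  have kN : (\row_i k i) *m (u%:M + N) = 0.
    apply/rowP => j; rewrite !mxE.
    transitivity (u * coord (map_tuple A c) j (\sum_i k i *: (map_tuple D c)`_i)).
      rewrite linear_sum mulr_sumr; apply: eq_bigr => i _.
      rewrite !mxE linearZ /= (nth_map 0) ?size_tuple //.
      rewrite add_lfunE scale_lfunE linearD linearZ /=.
      rewrite -[A _](nth_map 0 0) ?size_tuple // (coord_free _ _ freeX).
      rewrite -[in RHS]/(_ * _) -!/(_ * _) mulrCA; congr (_ * _).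
      by rewrite mulrDr -[in RHS]/(_ * _) mulVKf // mulr_natr.
    by rewrite sum0 linear0 mulr0.
  move=> i; move: (congr1 (mulmx^~ (invmx (u%:M + N))) kN).
  by rewrite /= mulmxK // mul0mx => /rowP/(_ i); rewrite !mxE.
have dimD : (\dim C <= \dim (limg D))%N.
  rewrite -(size_tuple (map_tuple D c)); have /eqP <- := freeD.
  by apply/dimvS/span_subvP => _ /mapP[v _ ->]; apply/memv_img/memvf.
have := limg_ker_dim D fullv; rewrite capfv => dD.
have := dimv_compl (lker A); rewrite -/C => dC.
have := dimvS (subvf (lker A)) => lA.
by move: le_n; rewrite -/D; move: dD dC lA dimD; lia.
Qed.

(** * The index of a subalgebra *)
Section Index.
Variables (K : fieldType) (L : vectType K).

Lemma linfun_linear (V W : vectType K) (g : V -> W) :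
  linear g -> linfun g =1 g.
Proof.
move=> g_lin; pose G : {linear V -> W} :=
  HB.pack g (GRing.isLinear.Build _ _ _ _ g g_lin).
exact: (lfunE G).
Qed.

Lemma linfun2_linear (V1 V2 W : vectType K) (g : V1 -> V2 -> W) :
  (forall y, linear (g^~ y)) -> (forall x, linear (g x)) ->
  forall x y, linfun (fun x => linfun (g x)) x y = g x y.
Proof.
move=> linl linr x y; rewrite linfun_linear ?linfun_linear // => c u v.
apply/lfunP => z; rewrite add_lfunE scale_lfunE !linfun_linear //.
exact: linl.
Qed.

Lemma lfunlZ (f : 'Hom(L, K^o)) c x : f (c *: x) = c * f x.
Proof. exact: linearZ. Qed.
Lemma lfunlD (f : 'Hom(L, K^o)) x y : f (x + y) = f x + f y.
Proof. exact: linearD. Qed.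
Lemma lfunlN (f : 'Hom(L, K^o)) x : f (- x) = - f x.
Proof. exact: linearN. Qed.
Lemma lfunlB (f : 'Hom(L, K^o)) x y : f (x - y) = f x - f y.
Proof. exact: linearB. Qed.

Variable br : L -> L -> L.
Hypothesis br_lie : lie_bracket br.

Let brDZl c x y z : br (c *: x + y) z = c *: br x z + br y z.
Proof. by case: br_lie => l _ _ _; exact: (l z c x y). Qed.
Let brDZr c x y z : br z (c *: x + y) = c *: br z x + br z y.
Proof. by case: br_lie => _ l _ _; exact: (l z c x y). Qed.

Lemma brDl x y z : br (x + y) z = br x z + br y z.
Proof. by have := brDZl 1 x y z; rewrite !scale1r. Qed.
Lemma brDr x y z : br z (x + y) = br z x + br z y.
Proof. by have := brDZr 1 x y z; rewrite !scale1r. Qed.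
Lemma br0l z : br 0 z = 0.
Proof. by apply: (addrI (br 0 z)); rewrite -brDl !addr0. Qed.
Lemma br0r z : br z 0 = 0.
Proof. by apply: (addrI (br z 0)); rewrite -brDr !addr0. Qed.
Lemma brZl c x z : br (c *: x) z = c *: br x z.
Proof. by have := brDZl c x 0 z; rewrite br0l !addr0. Qed.
Lemma brZr c x z : br z (c *: x) = c *: br z x.
Proof. by have := brDZr c x 0 z; rewrite br0r !addr0. Qed.
Lemma brC x y : br x y = - br y x.
Proof.
case: br_lie => _ _ alt _; have := alt (x + y).
rewrite brDl !brDr !alt add0r addr0 => /eqP.
by rewrite addr_eq0 => /eqP.
Qed.
Lemma brNl x z : br (- x) z = - br x z.
Proof. by rewrite -scaleN1r brZl scaleN1r. Qed.
Lemma brNr x z : br z (- x) = - br z x.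
Proof. by rewrite -scaleN1r brZr scaleN1r. Qed.
Lemma brBl x y z : br (x - y) z = br x z - br y z.
Proof. by rewrite brDl brNl. Qed.
Lemma brBr x y z : br z (x - y) = br z x - br z y.
Proof. by rewrite brDr brNr. Qed.
Lemma brxx x : br x x = 0.
Proof. by case: br_lie. Qed.
Lemma br_suml I (r : seq I) (P : pred I) (F : I -> L) z :
  br (\sum_(i <- r | P i) F i) z = \sum_(i <- r | P i) br (F i) z.
Proof.
by elim/big_rec2: _ => [|i x y _ <-]; rewrite ?br0l ?brDl.
Qed.
Lemma br_sumr I (r : seq I) (P : pred I) (F : I -> L) z :
  br z (\sum_(i <- r | P i) F i) = \sum_(i <- r | P i) br z (F i).
Proof.
by elim/big_rec2: _ => [|i x y _ <-]; rewrite ?br0r ?brDr.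
Qed.

Lemma br_derivation x y z : br x (br y z) = br (br x y) z + br y (br x z).
Proof.
case: br_lie => _ _ _ /(_ x y z) /eqP; rewrite addr_eq0 => /eqP jac.
have := congr1 (fun v => v - br y (br z x)) jac; rewrite addrK => ->.
by rewrite -(brC (br x y)) -brNr -(brC x z).
Qed.

Lemma br_lieA x y z : br (br x y) z = br x (br y z) - br y (br x z).
Proof. by rewrite br_derivation addrK. Qed.

Variable U : {vspace L}.
Hypothesis U_alg : subalgebra br U.

Lemma sub_bracketE (x y : subvs_of U) :
  vsval (sub_bracket br x y) = br (vsval x) (vsval y).
Proof. by rewrite /sub_bracket vsprojK // U_alg ?subvsP. Qed.

Lemma sub_bracket_lie : lie_bracket (@sub_bracket K L br U).
Proof.
split=> [y c u v|x c u v|x|x y z]; apply: subvs_inj.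
- by rewrite /= !sub_bracketE /= brDl brZl.
- by rewrite /= !sub_bracketE /= brDr brZr.
- by rewrite sub_bracketE brxx linear0.
- by rewrite !linearD /= !sub_bracketE; case: br_lie.
Qed.

Let incl : 'Hom(subvs_of U, L) := linfun vsval.
Let inclE x : incl x = vsval x.
Proof. by apply: linfun_linear => c u v; rewrite linearP. Qed.

(** The kernel of B_f on U, as a subspace of the ambient L, so that kernels for
    different subalgebras live in the same space and can be compared. *)
Definition rad (f : 'Hom(L, K^o)) : {vspace L} :=
  (linfun vsval @: form_ker (@sub_bracket K L br U) (f \o linfun vsval))%VS.

Lemma dim_rad f :
  \dim (rad f) = \dim (form_ker (@sub_bracket K L br U) (f \o linfun vsval)).
Proof.
apply: limg_dim_eq; apply/eqP; rewrite -subv0; apply/subvP => x.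
rewrite memv_cap memv_ker inclE memv0 => /andP[_ /eqP x0].
by apply/eqP/subvs_inj; rewrite x0 linear0.
Qed.

Lemma radP (f : 'Hom(L, K^o)) x :
  reflect (x \in U /\ {in U, forall y, f (br x y) = 0}) (x \in rad f).
Proof.
apply: (iffP memv_imgP) => [[u]|[xU f0]].
  move=> /(form_kerP _ _ sub_bracket_lie) fu0 ->; rewrite inclE subvsP.
  split=> // y yU; have := fu0 (vsproj U y).
  by rewrite comp_lfunE inclE sub_bracketE vsprojK.
exists (vsproj U x); last by rewrite inclE vsprojK.
apply/(form_kerP _ _ sub_bracket_lie) => y.
by rewrite comp_lfunE inclE sub_bracketE vsprojK // f0 ?subvsP.
Qed.

Definition has_index n :=
  (forall f : 'Hom(L, K^o), n <= \dim (rad f))%N /\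
  exists f : 'Hom(L, K^o), \dim (rad f) = n.

Lemma lie_index_has_index n :
  has_index n -> lie_index (@sub_bracket K L br U) = n.
Proof.
move=> [lb [f fn]]; rewrite /lie_index; case: ex_minnP => m.
move=> /boolp.asboolP[f' <-] min; apply/eqP; rewrite eqn_leq; apply/andP; split.
  by apply: min; apply/boolp.asboolP; exists (f \o incl)%VF; rewrite -dim_rad.
have := lb (f' \o linfun (vsproj U))%VF; rewrite dim_rad.
congr (n <= \dim (form_ker _ _))%N; apply/lfunP => x.
rewrite !comp_lfunE /= inclE linfun_linear ?vsvalK // => c u v.
by rewrite linearP.
Qed.

End Index.

(** A lower bound on the index may be checked on the forms that avoid a
    hyperplane: every form f is the end point of a punctured line f + s g of
    such forms. *)
Lemma rad_dim_perturb (K : numFieldType) (L : vectType K) (br : L -> L -> L)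
    (U : {vspace L}) (f g : 'Hom(L, K^o)) n :
  lie_bracket br -> subalgebra br U ->
  (forall s, s != 0 -> (n <= \dim (rad br U (f + s *: g)%R))%N) ->
  (n <= \dim (rad br U f))%N.
Proof.
move=> br_lie U_alg lb; rewrite dim_rad //.
have lie' := sub_bracket_lie br_lie U_alg.
pose B (f : 'Hom(L, K^o)) := linfun (fun x => linfun (fun y =>
   (f \o linfun vsval)%VF (@sub_bracket K L br U x y) : K^o)).
have BE h x y : B h x y = h (br (vsval x) (vsval y)).
  have [l r _ _] := lie'.
  have vE z : (linfun vsval : 'Hom(subvs_of U, L)) z = vsval z.
    exact: linfun_linear.
  rewrite /B linfun2_linear => [|z c u v|z c u v].
  - by rewrite comp_lfunE vE sub_bracketE.
  - by rewrite /= (l z c u v) linearP.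
  - by rewrite (r z c u v) linearP.
rewrite /form_ker -/(B f); apply: (@lker_dim_perturb _ _ _ _ (B g)) => s s0.
have -> : B f + s *: B g = B (f + s *: g).
  apply/lfunP => x; apply/lfunP => y.
  by rewrite add_lfunE scale_lfunE !BE add_lfunE scale_lfunE add_lfunE
     scale_lfunE !BE.
by have := lb s s0; rewrite dim_rad.
Qed.

(** * Cascades of orthogonal vectors *)

Section Dot.
Variables (R : realFieldType) (n : nat).
Implicit Types u v w b : 'rV[R]_n.

Definition dotp u v : R := \sum_i u 0 i * v 0 i.

Lemma dotpC u v : dotp u v = dotp v u.
Proof. by apply: eq_bigr => i _; rewrite mulrC. Qed.

Lemma dotpDl u v w : dotp (u + v) w = dotp u w + dotp v w.
Proof. by rewrite -big_split; apply: eq_bigr => i _; rewrite mxE mulrDl. Qed.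

Lemma dotpZl c u v : dotp (c *: u) v = c * dotp u v.
Proof. by rewrite mulr_sumr; apply: eq_bigr => i _; rewrite mxE mulrA. Qed.

Lemma dotpNl u v : dotp (- u) v = - dotp u v.
Proof. by rewrite -scaleN1r dotpZl mulN1r. Qed.

Lemma dotpBl u v w : dotp (u - v) w = dotp u w - dotp v w.
Proof. by rewrite dotpDl dotpNl. Qed.

Lemma dotpDr u v w : dotp w (u + v) = dotp w u + dotp w v.
Proof. by rewrite !(dotpC w) dotpDl. Qed.

Lemma dotpZr c u v : dotp v (c *: u) = c * dotp v u.
Proof. by rewrite !(dotpC v) dotpZl. Qed.

Lemma dotpNr u v : dotp v (- u) = - dotp v u.
Proof. by rewrite !(dotpC v) dotpNl. Qed.

Lemma dotpBr u v w : dotp w (u - v) = dotp w u - dotp w v.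
Proof. by rewrite !(dotpC w) dotpBl. Qed.

Lemma dotp0r u : dotp u 0 = 0.
Proof. by rewrite -(scale0r u) dotpZr mul0r. Qed.

Lemma dotp_gt0 u : u != 0 -> 0 < dotp u u.
Proof.
move=> u0; rewrite lt_def; have ge0 i : 0 <= u 0 i * u 0 i.
  by rewrite -expr2 sqr_ge0.
rewrite sumr_ge0 // andbT psumr_eq0 //; apply: contraNN u0 => /allP d0.
apply/eqP/rowP => i; have := d0 i (mem_index_enum _).
by rewrite mulf_eq0 orbb mxE => /eqP.
Qed.

Lemma dotp_delta u i : dotp u (delta_mx 0 i) = u 0 i.
Proof.
rewrite /dotp (bigD1 i) //= mxE !eqxx mulr1 big1 ?addr0 // => j ji.
by rewrite mxE (negPf ji) mulr0.
Qed.

(** Kostant's cascade of strongly orthogonal roots for a set P of positive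
    roots. Every root of P pairs with the coroot of the first member b to 2
    (b itself), 1 or 0; the roots pairing to 1 together with b span a
    Heisenberg algebra, in which b - v is the partner of v, and the roots
    orthogonal to b are treated by the rest of the cascade. *)
Fixpoint cascade (P : 'rV[R]_n -> Prop) (K : seq 'rV[R]_n) : Prop :=
  match K with
  | [::] => forall v, ~ P v
  | b :: K' =>
    [/\ P b,
        forall v, P v -> [\/ v = b, dotp v b = 0
                             | 2 * dotp v b = dotp b b /\ P (b - v)]
      & cascade (fun v => P v /\ dotp v b = 0) K']
  end.

Lemma cascade_ext (P Q : 'rV[R]_n -> Prop) K :
  (forall v, P v <-> Q v) -> cascade P K -> cascade Q K.
Proof.
elim: K P Q => [|b K IH] P Q PQ /=; first by move=> P0 v /PQ; apply: P0.
move=> [Pb Pv c]; split; [exact/PQ | | ].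
  move=> v /PQ /Pv[?|?|[? /PQ ?]]; [exact: Or31|exact: Or32|exact: Or33].
by apply: IH c => v; rewrite PQ.
Qed.

End Dot.

(** * Removal of a Heisenberg ideal *)

(** The setting is a Lie algebra U = <e> + <t> + V + U' graded by ad t in
    degrees 2, 0, 1, 0, where V + <e> is a Heisenberg ideal with centre <e> and
    the subalgebra U' centralises e and t. The families p and q are dual for the
    symplectic form of V: w has coordinate c i along q i when [p i, w] is
    c i times e. *)
Section Reduction.
Variables (K : numFieldType) (L : vectType K) (br : L -> L -> L).
Hypothesis br_lie : lie_bracket br.
Let brDl := brDl br_lie.
Let brDr := brDr br_lie.
Let brZl := brZl br_lie.
Let brZr := brZr br_lie.
Let brC := brC br_lie.
Let brNl := brNl br_lie.
Let brBl := brBl br_lie.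
Let brBr := brBr br_lie.
Let brxx := brxx br_lie.
Let br_suml := br_suml br_lie.
Let br_sumr := br_sumr br_lie.
Let br0r := br0r br_lie.
Let br_lieA := br_lieA br_lie.
Variables (U U' V : {vspace L}) (e t : L).
Variables (I : eqType) (s : seq I) (p q : I -> L).
Hypotheses (U_alg : subalgebra br U) (U'_alg : subalgebra br U').
Hypothesis U_sum : U = (<[e]> + <[t]> + V + U')%VS.
Hypothesis e_neq0 : e != 0.
Hypothesis br_te : br t e = 2 *: e.
Hypothesis br_tV : {in V, forall v, br t v = v}.
Hypothesis br_tU' : {in U', forall x, br t x = 0}.
Hypothesis br_eV : {in V, forall v, br e v = 0}.
Hypothesis br_eU' : {in U', forall x, br e x = 0}.
Hypothesis br_VV : {in V &, forall v w, br v w \in <[e]>%VS}.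
Hypothesis br_U'V : {in U' & V, forall x v, br x v \in V}.
Hypothesis p_V : {in s, forall i, p i \in V}.
Hypothesis V_dual : {in V, forall w, exists c : I -> K,
  w = \sum_(i <- s) c i *: q i /\ {in s, forall i, br (p i) w = c i *: e}}.

Lemma reduction_decomp z : z \in U -> exists a b : K, exists2 w, w \in V &
  exists2 x, x \in U' & z = a *: e + b *: t + w + x.
Proof.
rewrite U_sum => /memv_addP[y /memv_addP[u /memv_addP[e' /vlineP[a ->]]]].
move=> [t' /vlineP[b ->] ->] [w wV ->] [x xU' ->].
by exists a, b, w => //; exists x.
Qed.

Let U'U x : x \in U' -> x \in U.
Proof. by move=> xU'; rewrite U_sum; apply: (subvP (addvSr _ _)). Qed.
Let VU x : x \in V -> x \in U.
Proof.
move=> xV; rewrite U_sum; apply: (subvP (addvSl _ _)).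
exact: (subvP (addvSr _ _)).
Qed.
Let eU : e \in U.
Proof. by rewrite U_sum -!addvA; apply: (subvP (addvSl _ _)); apply: memv_line. Qed.

Section GenericForm.
Variable f : 'Hom(L, K^o).
Hypothesis fe_neq0 : f e != 0.

(** The unique v(x) in V such that x + v(x) is orthogonal to V for B_f; it
    exists because f does not vanish on the centre e of the Heisenberg
    algebra. *)
Definition red_corr : 'End(L) :=
  linfun (fun x => - \sum_(i <- s) (f (br x (q i)) / f e) *: p i).

Lemma red_corrE x :
  red_corr x = - \sum_(i <- s) (f (br x (q i)) / f e) *: p i.
Proof.
apply: linfun_linear => c u v; rewrite scalerN -opprD; congr (- _).
rewrite scaler_sumr -big_split; apply: eq_bigr => i _ /=.
by rewrite brDl // brZl // lfunlD lfunlZ mulrDl scalerDl scalerA mulrA.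
Qed.

Lemma red_corr_V x : red_corr x \in V.
Proof.
rewrite red_corrE memvN big_seq; apply: memv_suml => i /p_V pV.
exact: memvZ.
Qed.

Lemma red_corrP x w : w \in V -> f (br (red_corr x) w) = - f (br x w).
Proof.
move=> /V_dual[c [wE pw]]; rewrite red_corrE brNl // lfunlN; congr (- _).
rewrite br_suml // linear_sum /= {2}wE br_sumr // linear_sum /= !big_seq.
apply: eq_bigr => i si; rewrite brZl // pw // brZr // !lfunlZ.
by rewrite mulrCA divfK.
Qed.

Lemma V_eq0 v : v \in V -> {in V, forall w, f (br v w) = 0} -> v = 0.
Proof.
move=> vV v0; have [c [vE pv]] := V_dual vV.
rewrite vE big_seq big1 // => i si; have := v0 _ (p_V si).
rewrite brC // pv // lfunlN lfunlZ => /eqP.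
by rewrite oppr_eq0 mulf_eq0 (negPf fe_neq0) orbF => /eqP ->; rewrite scale0r.
Qed.

(** The map v is a cocycle on U': both sides have the same pairing with every
    w in V, since [v(y), w] is a multiple of e and hence killed by U', so that
    f([[x, v(y)], w]) = - f([v(y), [x, w]]) = f([y, [x, w]]). *)
Lemma red_corr_br x y : x \in U' -> y \in U' ->
  red_corr (br x y) = br x (red_corr y) - br y (red_corr x).
Proof.
move=> xU yU; apply/eqP; rewrite -subr_eq0; apply/eqP.
have xyV : br x (red_corr y) - br y (red_corr x) \in V.
  by rewrite memvB ?br_U'V ?red_corr_V.
apply: V_eq0 => [|w wV]; first by rewrite memvB ?red_corr_V.
have half x' y' : x' \in U' -> y' \in U' ->
    f (br (br x' (red_corr y')) w) = f (br y' (br x' w)).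
  move=> x'U y'U; rewrite br_lieA // lfunlB /=.
  have /vlineP[k ->] := br_VV (red_corr_V y') wV.
  rewrite brZr // [br x' e]brC // br_eU' // oppr0 scaler0 linear0 sub0r.
  by rewrite red_corrP ?br_U'V // opprK.
rewrite brBl // lfunlB /= red_corrP // brBl // lfunlB /= !half //.
by rewrite br_lieA // lfunlB /=; ring.
Qed.

(** The Schur complement of V in B_f is f([x, y]) - f([v(x), v(y)]). The cocycle
    identity makes it again of the form B_f', for f' = f + f v / 2. *)
Definition red_form : 'Hom(L, K^o) := f + 2^-1 *: (f \o red_corr)%VF.

Lemma red_formE x y : x \in U' -> y \in U' ->
  red_form (br x y) = f (br x y) - f (br (red_corr x) (red_corr y)).
Proof.
move=> xU yU; rewrite add_lfunE scale_lfunE comp_lfunE red_corr_br //.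
have E x' y' : f (br x' (red_corr y')) = - f (br (red_corr x') (red_corr y')).
  by rewrite red_corrP ?opprK ?red_corr_V.
rewrite lfunlB (E x y) (E y x).
rewrite [br (red_corr y) _]brC // lfunlN -[_ *: _]/(_ * _).
by field.
Qed.

(** Elimination of e, t and V from a kernel vector x of B_f': the summand v(x)
    makes it orthogonal to V, and the multiple of e makes it orthogonal
    to t. *)
Let red_map := linfun (fun x => x + red_corr x - (f (red_corr x) / (2 * f e)) *: e).
Let red_mapE x : red_map x = x + red_corr x - (f (red_corr x) / (2 * f e)) *: e.
Proof.
apply: linfun_linear => c u v; rewrite linearP lfunlD lfunlZ mulrDl scalerDl.
rewrite !scalerDr scalerN scalerA mulrA opprD !addrA.
by rewrite [LHS](ACl (1*3*5*2*4*6)%AC).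
Qed.

Lemma dim_rad_red_form :
  (\dim (rad br U' red_form) <= \dim (rad br U f))%N.
Proof.
have inj : (rad br U' red_form :&: lker red_map)%VS = 0%VS.
  apply/eqP; rewrite -subv0; apply/subvP => x.
  rewrite memv_cap memv_ker red_mapE memv0 => /andP[/(radP br_lie U'_alg)[xU _]].
  set v := red_corr x; set k := _ / _ => /eqP z0.
  have vV : v \in V := red_corr_V x.
  (* ad t separates the degrees of V, <e> and U'. *)
  have z1 : v - (2 * k) *: e = 0.
    have := congr1 (br t) z0; rewrite br0r // brBr // brDr // br_tU' // add0r.
    by rewrite br_tV // brZr // br_te scalerA [k * 2]mulrC.
  have z2 : v - (4 * k) *: e = 0.
    have := congr1 (br t) z1; rewrite br0r // brBr //.
    rewrite br_tV // brZr // br_te scalerA => <-; congr (_ - _ *: _).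
    by ring.
  have ke0 : k *: e = 0.
    have: (v - (2 * k) *: e) - (v - (4 * k) *: e) = 0 by rewrite z1 z2 subr0.
    rewrite opprB addrC -addrA addKr // -scalerBl -mulrBl => /eqP.
    rewrite !scaler_eq0 mulf_eq0 -natrB // pnatr_eq0 /= => ke.
    by apply/eqP; rewrite scaler_eq0.
  have v0 : v = 0 by move: z1; rewrite -scalerA ke0 scaler0 subr0.
  by move: z0; rewrite ke0 v0 subr0 addr0 => ->.
rewrite -(limg_dim_eq inj); apply/dimvS/subvP => z /memv_imgP[x].
move=> /(radP br_lie U'_alg)[xU' x0] ->; rewrite red_mapE.
set k := _ / _; have vV := red_corr_V x.
apply/radP => //; split.
  apply: memvB; last exact: memvZ.
  by apply: memvD; [exact: U'U | exact: VU].
move=> y /reduction_decomp[a [b [w wV [u uU' ->]]]].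
rewrite !brDr // !brZr //. rewrite !lfunlD !lfunlZ.
have -> : br (x + red_corr x - k *: e) e = 0.
  rewrite brBl // brDl // brZl // brxx // scaler0 subr0.
  by rewrite [br x e]brC // br_eU' // [br _ e]brC // br_eV // !oppr0 addr0.
have -> : f (br (x + red_corr x - k *: e) t) = 0.
  rewrite brC // brBr // brDr // br_tU' // br_tV // brZr // br_te.
  rewrite add0r lfunlN lfunlB scalerA lfunlZ /k /=.
  have f2 : 2 * f e != 0 by rewrite mulf_neq0 ?pnatr_eq0.
  by rewrite -[_ * 2 * _]mulrA divfK // subrr oppr0.
have -> : f (br (x + red_corr x - k *: e) w) = 0.
  rewrite brBl // brDl // brZl // br_eV // scaler0 subr0 lfunlD /=.
  by rewrite red_corrP // addrN.
rewrite linear0 !mulr0 !add0r brBl // brDl // brZl // br_eU' // scaler0 subr0.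
rewrite lfunlD /= -(x0 u uU') red_formE //; congr (_ + _).
rewrite [br (red_corr x) u]brC [br (red_corr x) (red_corr u)]brC !lfunlN.
by rewrite opprK red_corrP ?red_corr_V.
Qed.

End GenericForm.

Lemma functional_dual : exists g : 'Hom(L, K^o), g e = 1.
Proof.
exists (linfun (coord [tuple e] ord0 : L -> K^o)).
rewrite linfun_linear; first by rewrite (coord_free ord0 ord0) ?seq1_free.
exact: coord_is_scalar.
Qed.

(** Lower bound: the forms that do not vanish on e are covered by the Schur
    complement, the others by perturbation. Upper bound: a form f' of minimal
    kernel on U' is extended by 0 on V and by 1 on e, and then e, t and V
    contribute nothing to the kernel. *)
Lemma has_index_reduction n : has_index br U' n -> has_index br U n.
Proof.
have [g ge] := functional_dual.
have brl (x : L) (c : K) (u v : L) : br x (c *: u + v) = c *: br x u + br x v.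
  by rewrite brDr // brZr.
move=> [lb [f' f'n]].
have ub (f : 'Hom(L, K^o)) : f e != 0 -> (n <= \dim (rad br U f))%N.
  move=> fe; exact: leq_trans (lb _) (dim_rad_red_form fe).
split.
  move=> f; have [fe|fe] := eqVneq (f e) 0; last exact: ub.
  apply: (@rad_dim_perturb _ _ _ _ _ g) => // s' s0; apply: ub.
  by rewrite add_lfunE scale_lfunE fe ge add0r [_ *: _]mulr1.
(* The polynomials 1 - (3 T - T^2) / 2 and (T^2 - T) / 2 of T = ad t project
   onto the degrees 0 and 2. *)
pose T : 'End(L) := linfun (br t).
have TE x : T x = br t x by apply: linfun_linear => c u v.
pose f : 'Hom(L, K^o) :=
  f' - 2^-1 *: (f' \o (3 *: T - (T \o T)))%VF +
  2^-1 *: (g \o ((T \o T) - T))%VF.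
have fE x : f x = f' (x - 2^-1 *: (3 *: br t x - br t (br t x)))
                + g (2^-1 *: (br t (br t x) - br t x)).
  rewrite !(add_lfunE, opp_lfunE, scale_lfunE, comp_lfunE, TE).
  by rewrite [f' (x - _)]lfunlB [f' (2^-1 *: _)]lfunlZ [g (2^-1 *: _)]lfunlZ.
have fU' x : x \in U' -> f x = f' x.
  by move=> xU; rewrite fE br_tU' // br0r // scaler0 !subr0 scaler0 subr0 !linear0 addr0.
have fV x : x \in V -> f x = 0.
  move=> xV; rewrite fE !br_tV // subrr scaler0 linear0 addr0.
  rewrite -[X in 3 *: x - X]scale1r -scalerBl scalerA.
  have -> : 2^-1 * (3 - 1) = 1 :> K by field.
  by rewrite scale1r subrr linear0.
have fe : f e = 1.
  rewrite fE !br_te brZr // br_te !scalerA -!scalerBl !scalerA.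
  have -> : 2^-1 * (2 * 2 - 2) = 1 :> K by field.
  have -> : 2^-1 * (3 * 2 - 2 * 2) = 1 :> K by field.
  by rewrite !scale1r subrr linear0 add0r.
exists f; rewrite -f'n; congr (\dim _); apply/vspaceP => z.
apply/(radP br_lie U_alg)/(radP br_lie U'_alg) => [[zU z0]|[zU z0]]; last first.
  split=> [|y /reduction_decomp[a [b [w wV [u uU' ->]]]]]; first exact: U'U.
  rewrite !brDr // !brZr // [br z e]brC // br_eU' // [br z t]brC // br_tU' //.
  rewrite oppr0 !scaler0 !add0r lfunlD /= fV ?br_U'V // add0r fU' ?z0 //.
  exact: U'_alg.
have [a [b [w wV [x xU' zE]]]] := reduction_decomp zU.
have b0 : b = 0.
  have := z0 _ eU; rewrite zE !brDl // !brZl // brxx // br_te.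
  rewrite [br w e]brC // br_eV // [br x e]brC // br_eU' // !oppr0 scaler0.
  rewrite !addr0 add0r !lfunlZ fe mulr1 => /eqP.
  by rewrite mulf_eq0 pnatr_eq0 orbF => /eqP.
have w0 : w = 0.
  apply: (@V_eq0 f); rewrite ?fe ?oner_eq0 // => w' w'V.
  have := z0 _ (VU w'V); rewrite zE b0 scale0r addr0 !brDl // brZl // br_eV //.
  by rewrite scaler0 add0r lfunlD /= [f (br x w')]fV ?br_U'V // addr0.
have a0 : a = 0.
  have tU : t \in U.
    rewrite U_sum -!addvA; apply: (subvP (addvSr _ _)).
    by apply: (subvP (addvSl _ _)); apply: memv_line.
  have := z0 _ tU; rewrite zE b0 w0 scale0r !addr0 brDl // brZl //.
  rewrite [br e t]brC // [br x t]brC // br_te br_tU' // oppr0 addr0.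
  rewrite scalerN lfunlN scalerA lfunlZ fe mulr1 => /eqP.
  by rewrite oppr_eq0 mulf_eq0 pnatr_eq0 orbF => /eqP.
have -> : z = x by rewrite zE a0 b0 w0 !scale0r !add0r.
split=> // y yU'; rewrite -fU' ?U'_alg //.
by have := z0 _ (U'U yU'); rewrite zE a0 b0 w0 !scale0r !add0r.
Qed.

End Reduction.

Lemma has_index_abelian (K : fieldType) (L : vectType K) (br : L -> L -> L)
    (U : {vspace L}) :
  lie_bracket br -> {in U &, forall x y, br x y = 0} -> has_index br U (\dim U).
Proof.
move=> br_lie ab; have alg : subalgebra br U.
  by move=> x y xU yU; rewrite ab ?mem0v.
have radU (f : 'Hom(L, K^o)) : rad br U f = U.
  apply/vspaceP => x; apply/(radP br_lie alg)/idP => [[]//|xU].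
  by split=> // y yU; rewrite ab // linear0.
by split=> [f|]; [rewrite radU | exists 0; rewrite radU].
Qed.

(** * Split simple Lie algebras *)

Section SplitSimple.
Variables (R : realFieldType) (g : vectType R) (br : g -> g -> g).
Variables (h : {vspace g}) (Delta : seq (dual h)).
Hypotheses (br_lie : lie_bracket br) (g_simple : lie_simple br).
Hypotheses (h_cartan : cartan_subalgebra br h).
Hypotheses (Delta_roots : root_system br Delta).
Hypotheses (g_split : split_wrt br Delta).

Let brDl := brDl br_lie.
Let brDr := brDr br_lie.
Let brZl := brZl br_lie.
Let brZr := brZr br_lie.
Let brC := brC br_lie.
Let brNl := brNl br_lie.
Let br_suml := br_suml br_lie.
Let br_sumr := br_sumr br_lie.
Let br0r := br0r br_lie.
Let br_lieA := br_lieA br_lie.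
Local Notation rootspace := (@rootspace R g br h).
Implicit Types (a b d : dual h) (u : subvs_of h) (x y z : g).

Definition rvec (a : dual h) : g := vpick (rootspace a).

Lemma rvec_mem a : rvec a \in rootspace a.
Proof. exact: memv_pick. Qed.

Lemma rvec_neq0 a : a \in Delta -> rvec a != 0.
Proof. by case: Delta_roots => _ D /D[_]; rewrite vpick0. Qed.

Lemma rootspaceE a : a \in Delta -> rootspace a = <[rvec a]>%VS.
Proof.
move=> aD; case: g_split => _ _ /(_ a aD) d1.
apply/eqP; rewrite eq_sym eqEdim -memvE rvec_mem d1.
by rewrite dim_vline rvec_neq0.
Qed.

Lemma root_neq0 a : a \in Delta -> a != 0.
Proof. by case: Delta_roots => _ D /D[]. Qed.

Lemma rootspace_br a b x y :
  x \in rootspace a -> y \in rootspace b -> br x y \in rootspace (a + b).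
Proof.
move=> /(rootspaceP _ _ br_lie) xa /(rootspaceP _ _ br_lie) yb.
apply/(rootspaceP _ _ br_lie) => u.
rewrite br_derivation // xa yb brZl brZr add_lfunE scalerDl.
by [].
Qed.

Lemma rootspace_mem x a : x \in rootspace a -> x != 0 -> a != 0 -> a \in Delta.
Proof.
move=> xa x0 a0; case: Delta_roots => _ D; apply/D; split=> //.
by apply: contraNneq x0 => E; rewrite -memv0 -E.
Qed.

Lemma rvec_br_eq0 a b : a + b != 0 -> a + b \notin Delta ->
  br (rvec a) (rvec b) = 0.
Proof.
move=> ab0 abD; apply/eqP; apply: contraNT abD => nz.
exact: rootspace_mem (rootspace_br (rvec_mem a) (rvec_mem b)) nz ab0.
Qed.

(** The form in which the root space decomposition is used: a subspace that
    contains h and a vector of each root space is everything. *)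
Lemma split_full (W : {vspace g}) :
  (h <= W)%VS -> {in Delta, forall a, rvec a \in W} -> W = fullv.
Proof.
move=> hW rW; apply/eqP; rewrite eqEsubv subvf; case: g_split => <- _ _.
rewrite subv_add hW; apply/subv_sumP => i _.
have iD : Delta`_i \in Delta by apply: mem_nth.
by rewrite rootspaceE // -memvE rW.
Qed.

Lemma br_h_rvec (u : subvs_of h) a : br (vsval u) (rvec a) = a u *: rvec a.
Proof. by have /(rootspaceP _ _ br_lie) := rvec_mem a. Qed.

Lemma cartan_br x y : x \in h -> y \in h -> br x y \in h.
Proof. by case: h_cartan => + _ _; apply. Qed.

(** Since h acts on a root space through a character, roots vanish on
    [h, h]. *)
Lemma root_cartan_br a (x y : subvs_of h) : a \in Delta ->
  a (vsproj h (br (vsval x) (vsval y))) = 0.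
Proof.
move=> aD; set u := vsproj _ _.
have uE : vsval u = br (vsval x) (vsval y) by rewrite vsprojK ?cartan_br ?subvsP.
have /eqP : a u *: rvec a = 0.
  rewrite -br_h_rvec uE br_lieA !br_h_rvec !brZr !br_h_rvec !scalerA.
  by rewrite mulrC subrr.
by rewrite scaler_eq0 (negPf (rvec_neq0 aD)) orbF => /eqP.
Qed.

Lemma mem_liev (U V : {vspace g}) x y : x \in U -> y \in V ->
  br x y \in liev br U V.
Proof.
move=> /coord_vbasis-> /coord_vbasis->; rewrite br_suml; apply: memv_suml => i _.
rewrite br_sumr; apply: memv_suml => j _; rewrite brZl brZr !memvZ //.
by apply: memv_span; apply: allpairs_f; apply: mem_nth; rewrite size_tuple.
Qed.

Lemma liev_ideal : lie_ideal br (liev br fullv fullv).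
Proof. by move=> x y _; apply: mem_liev; apply: memvf. Qed.

(** Otherwise g is nilpotent, whereas the ideal [g, g] is nonzero, hence equal
    to g by simplicity, and the lower central series is constant. *)
Lemma cartan_proper : h <> fullv.
Proof.
move=> hf; case: h_cartan => _ [n]; rewrite hf; case: g_simple => -[x [y xy0]].
have nz : fullv <> 0%VS :> {vspace g}.
  by move=> f0; apply: xy0; apply/eqP; rewrite -memv0 -f0 memvf.
move=> /(_ _ liev_ideal)[l0|lf].
  by case: xy0; apply/eqP; rewrite -memv0 -l0 mem_liev ?memvf.
have -> : iter n (liev br fullv) fullv = fullv by elim: n => //= n ->.
by move/nz.
Qed.

Let root_on (a : dual h) : 'Hom(g, R^o) := (a \o linfun (vsproj h))%VF.
Let root_onE a x : root_on a x = a (vsproj h x).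
Proof.
rewrite comp_lfunE linfun_linear // => c u v.
by rewrite linearP.
Qed.

(** The elements of h killed by all roots form an ideal, because they contain
    [h, h] and commute with the root spaces. It is not g, so it is zero. *)
Lemma roots_separate (u : subvs_of h) : {in Delta, forall a, a u = 0} -> u = 0.
Proof.
move=> u0.
pose Z := (h :&: \bigcap_(i < size Delta) lker (root_on Delta`_i))%VS.
have ZP x : x \in Z <-> x \in h /\ {in Delta, forall a, a (vsproj h x) = 0}.
  rewrite memv_cap; split=> [/andP[-> xZ]|[-> xD]].
    split=> // a /(nthP 0)[i iD <-]; move: xZ.
    rewrite memvE => /subv_bigcapP/(_ (Ordinal iD) isT).
    by rewrite -memvE memv_ker root_onE => /eqP.
  rewrite memvE; apply/subv_bigcapP => i _; rewrite -memvE memv_ker root_onE xD //.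
  exact: mem_nth.
have Zideal : lie_ideal br Z.
  move=> x y /ZP[yh yD].
  pose ady : 'End(g) := linfun (fun x => br x y).
  have adyE z : ady z = br z y.
    by apply: linfun_linear => c v w; rewrite brDl brZl.
  suff /vspaceP/(_ x) : (ady @^-1: Z)%VS = fullv by rewrite memvf -memv_preim adyE.
  apply: split_full => [|a aD].
    apply/subvP => z zh; rewrite -memv_preim adyE; apply/ZP; split.
      exact: cartan_br.
    move=> a aD; rewrite -(vsprojK yh) -(vsprojK zh).
    exact: root_cartan_br.
  rewrite -memv_preim adyE brC -(vsprojK yh) br_h_rvec yD // scale0r oppr0.
  exact: mem0v.
have [Z0|Zf] := g_simple.2 Z Zideal.
  apply/subvs_inj/eqP; rewrite -memv0 -Z0; apply/ZP; rewrite subvsP; split=> // a aD.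
  by rewrite vsvalK u0.
case: cartan_proper; apply/vspaceP => x; rewrite memvf.
have : x \in Z by rewrite Zf memvf.
by case/ZP.
Qed.

Lemma cartan_abelian x y : x \in h -> y \in h -> br x y = 0.
Proof.
move=> xh yh; rewrite -(vsprojK (cartan_br xh yh)).
rewrite (@roots_separate (vsproj h (br x y))) ?linear0 // => a aD.
by rewrite -{1}(vsprojK xh) -(vsprojK yh) root_cartan_br.
Qed.

Lemma rootspace0 : rootspace 0 = h.
Proof.
apply/vspaceP => x; apply/idP/idP => [|xh].
  move=> /(rootspaceP _ _ br_lie) x0; case: h_cartan => _ _; apply => y yh.
  by rewrite brC -(vsprojK yh) x0 zero_lfunE scale0r oppr0 mem0v.
apply/(rootspaceP _ _ br_lie) => y.
by rewrite cartan_abelian ?subvsP // zero_lfunE scale0r.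
Qed.

Let X := vbasis h ++ [seq rvec a | a <- Delta].

Lemma split_basis : basis_of fullv X.
Proof.
rewrite basisEdim; apply/andP; split.
  rewrite [in X in (X <= _)%VS](_ : fullv = <<X>>%VS) //; apply/esym/split_full.
    rewrite -{1}(span_basis (vbasisP h)); apply: sub_span => x xh.
    by rewrite mem_cat xh.
  by move=> a aD; apply: memv_span; rewrite mem_cat (map_f rvec aD) orbT.
case: g_split => <- /directvP /= -> d1; rewrite size_cat size_tuple leq_add2l.
rewrite size_map -[X in (X <= _)%N]card_ord -sum1_card; apply: leq_sum => i _.
by rewrite d1 // mem_nth.
Qed.

Let Xt := in_tuple X.
Let N := size X.
Let crd (j : 'I_N) (x : g) : R := coord Xt j x.
Let crdD j x y : crd j (x + y) = crd j x + crd j y. Proof. exact: linearD. Qed.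
Let crdZ j c x : crd j (c *: x) = c * crd j x. Proof. exact: linearZ. Qed.
Let crd_sum x : x = \sum_j crd j x *: X`_j.
Proof. exact: (coord_basis (X := Xt) split_basis (memvf x)). Qed.

Let adM x : 'M[R]_N := \matrix_(i, j) crd j (br x X`_i).

Let adMP c x y : adM (c *: x + y) = c *: adM x + adM y.
Proof. by apply/matrixP => i j; rewrite !mxE brDl brZl crdD crdZ. Qed.

Let adM_mul x y : adM y *m adM x = \matrix_(i, j) crd j (br x (br y X`_i)).
Proof.
apply/matrixP => i j; rewrite !mxE [in RHS](crd_sum (br y _)) br_sumr.
rewrite /crd linear_sum /=; apply: eq_bigr => k _.
by rewrite !mxE brZr linearZ.
Qed.

Let adM_br x y : adM (br x y) = adM y *m adM x - adM x *m adM y.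
Proof.
rewrite !adM_mul; apply/matrixP => i j.
by rewrite !mxE br_lieA -scaleN1r addrC crdD crdZ mulN1r addrC.
Qed.

(** The Killing form, computed in a basis adapted to the decomposition, where
    the elements of h act diagonally. *)
Definition killing x y := \tr (adM x *m adM y).

Lemma killingC x y : killing x y = killing y x.
Proof. exact: mxtrace_mulC. Qed.

Lemma killingP c x y z : killing (c *: x + y) z = c * killing x z + killing y z.
Proof. by rewrite /killing adMP mulmxDl mxtraceD -scalemxAl mxtraceZ. Qed.

Lemma killing_inv x y z : killing (br x y) z = killing x (br y z).
Proof.
rewrite /killing !adM_br mulmxBl mulmxBr !raddfB /=; congr (_ - _).
  by rewrite mxtrace_mulC mulmxA mxtrace_mulC mulmxA.
by rewrite mulmxA.
Qed.

Lemma killingZl c x z : killing (c *: x) z = c * killing x z.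
Proof.
have k0 : killing 0 z = 0.
  by have := killingP (-1) 0 0 z; rewrite scaler0 addr0 mulN1r addNr.
by have := killingP c x 0 z; rewrite addr0 k0 addr0.
Qed.

(** On h the Killing form is the sum of the squares of the roots, so it is
    positive definite over an ordered field. This replaces Cartan's criterion
    in the proof that it is nondegenerate. *)
Lemma killing_cartan_pos x : x \in h -> killing x x = 0 -> x = 0.
Proof.
move=> xh; pose d (i : 'I_N) := crd i (br x X`_i).
have brX (i : 'I_N) : br x X`_i = d i *: X`_i.
  have [m mE] : exists m, br x X`_i = m *: X`_i.
    have : X`_i \in X by apply: mem_nth.
    rewrite mem_cat => /orP[/vbasis_mem ih|/mapP[a aD ->]].
      by exists 0; rewrite cartan_abelian // scale0r.
    by exists (a (vsproj h x)); rewrite -{1}(vsprojK xh) br_h_rvec.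
  rewrite mE /d mE crdZ /crd coord_free ?eqxx ?mulr1 //.
  exact: basis_free split_basis.
have adME : adM x = diag_mx (\row_i d i).
  apply/matrixP => i j; rewrite !mxE brX crdZ /crd coord_free ?mulr_natr //.
  exact: basis_free split_basis.
rewrite /killing adME mulmx_diag mxtrace_diag => /eqP.
rewrite psumr_eq0 => [|i _]; last by rewrite !mxE -expr2 sqr_ge0.
move=> /allP d0; rewrite -(vsprojK xh) (@roots_separate (vsproj h x)) ?linear0 //.
move=> a aD; have : rvec a \in X by rewrite mem_cat (map_f rvec aD) orbT.
move=> /(nthP 0)[i ltin iE].
have := d0 (Ordinal ltin) (mem_index_enum _); rewrite !mxE mulf_eq0 orbb => /eqP di.
have := brX (Ordinal ltin); rewrite di scale0r iE -{1}(vsprojK xh) br_h_rvec.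
move/eqP; rewrite scaler_eq0 (negPf (rvec_neq0 aD)) orbF.
by move=> /eqP.
Qed.

Lemma cartan_neq0 : h <> 0%VS.
Proof.
move=> h0; case: cartan_proper; apply/vspaceP => x; rewrite memvf.
case: h_cartan => _ _; apply => y; rewrite h0 memv0 => /eqP ->.
by rewrite br0r mem0v.
Qed.

(** The radical is an ideal, and it is not g because h is nonzero and the form
    is definite on it. *)
Lemma killing_nondegenerate x : (forall y, killing x y = 0) -> x = 0.
Proof.
pose rk := lker (linfun (fun x => linfun (fun y => killing x y : R^o))).
have rkP z : z \in rk <-> forall y, killing z y = 0.
  have kE y y' : linfun (fun x => linfun (fun y => killing x y : R^o)) y y'
      = killing y y'.
    apply: linfun2_linear => [z' c z1 z2|z' c z1 z2]; first exact: killingP.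
    by rewrite killingC killingP ![killing _ z']killingC.
  rewrite memv_ker; split=> [/eqP z0 y|z0]; first by rewrite -kE z0 zero_lfunE.
  by apply/eqP/lfunP => y; rewrite kE z0 zero_lfunE.
have rk_ideal : lie_ideal br rk.
  move=> y z /rkP v0; apply/rkP => w.
  by rewrite brC -scaleN1r killingZl killing_inv v0 mulr0.
move=> /rkP; have [->|rkf] := g_simple.2 rk rk_ideal; first by rewrite memv0 => /eqP.
case: cartan_neq0; apply/eqP; rewrite -subv0; apply/subvP => y yh.
rewrite memv0; apply/eqP/killing_cartan_pos => //.
by have /rkP : y \in rk; [rewrite rkf memvf | apply].
Qed.

Lemma killing_orth a b x y : a + b != 0 ->
  x \in rootspace a -> y \in rootspace b -> killing x y = 0.
Proof.
move=> /lfunPn[u]; rewrite zero_lfunE add_lfunE => u0.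
move=> /(rootspaceP _ _ br_lie)/(_ u) xa /(rootspaceP _ _ br_lie)/(_ u) yb.
have := killing_inv x (vsval u) y.
rewrite brC xa yb -scaleNr killingZl [killing x (_ *: _)]killingC killingZl.
rewrite [killing y x]killingC => /eqP; rewrite eq_sym mulNr -addr_eq0 -mulrDl.
by rewrite mulf_eq0 addrC (negPf u0) => /eqP.
Qed.

(** The vector of the root a is orthogonal to h and to all root spaces except
    that of - a; by nondegeneracy that one is present. *)
Lemma root_opp a : a \in Delta ->
  - a \in Delta /\ killing (rvec a) (rvec (- a)) != 0.
Proof.
move=> aD; have [/andP[->]//|abs] :=
  boolP ((- a \in Delta) && (killing (rvec a) (rvec (- a)) != 0)).
case/eqP: (rvec_neq0 aD); apply: killing_nondegenerate => y.
pose ka : 'Hom(g, R^o) := linfun (killing (rvec a) : g -> R^o).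
have kaE z : ka z = killing (rvec a) z.
  apply: linfun_linear => c u v.
  by rewrite killingC killingP ![killing _ (rvec a)]killingC.
suff kf : lker ka = fullv.
  have : y \in lker ka by rewrite kf memvf.
  by rewrite memv_ker kaE => /eqP.
apply: split_full => [|b bD].
  apply/subvP => z zh; rewrite memv_ker kaE (@killing_orth a 0) ?rvec_mem //.
    by rewrite addr0 root_neq0.
  by rewrite rootspace0.
rewrite memv_ker kaE; have [ab0|ab0] := eqVneq (a + b) 0; last first.
  by rewrite (killing_orth ab0) ?rvec_mem.
have bE : b = - a by apply/eqP; rewrite -addr_eq0 addrC ab0.
by move: abs; rewrite -bE bD /= negbK.
Qed.

(** The bracket t of opposite root vectors is a nonzero multiple of the dual of
    a for the Killing form, so a(t) is a nonzero multiple of the Killing square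
    of t, which is nonzero by definiteness. *)
Lemma root_sl2 a : a \in Delta -> exists T : subvs_of h, exists F,
  [/\ F \in rootspace (- a), br (rvec a) F = vsval T & a T = 2].
Proof.
move=> aD; have [naD k0] := root_opp aD.
set k := killing _ _ in k0; pose t := br (rvec a) (rvec (- a)).
have th : t \in h.
  by rewrite -rootspace0 -(subrr a) rootspace_br ?rvec_mem.
have kt (s : subvs_of h) : killing t (vsval s) = - a s * - k.
  rewrite /t brC -scaleN1r killingZl killing_inv brC br_h_rvec -scaleNr.
  by rewrite [killing _ (_ *: _)]killingC killingZl /k; ring.
have t0 : t != 0.
  apply: contraTneq k0 => t0; have /lfunPn[s] := root_neq0 aD.
  rewrite zero_lfunE => as0; have := kt s.
  have -> : killing t (vsval s) = 0 by rewrite t0 -(scale0r t) killingZl mul0r.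
  by move/eqP; rewrite mulrNN eq_sym mulf_eq0 (negPf as0) /= => /eqP ->; rewrite eqxx.
have at0 : a (vsproj h t) != 0.
  apply: contraNneq t0 => at0; apply/eqP/killing_cartan_pos => //.
  by rewrite -{2}(vsprojK th) kt at0 oppr0 mul0r.
exists ((2 / a (vsproj h t)) *: vsproj h t), ((2 / a (vsproj h t)) *: rvec (- a)).
split; first by rewrite memvZ ?rvec_mem.
  by rewrite brZr linearZ /= vsprojK.
by rewrite linearZ /= [_ *: _]divfK.
Qed.

Lemma no_infinite_string (c a : dual h) (w : nat -> g) : a != 0 ->
  (forall k, w k \in rootspace (c + a *+ k)) -> exists k, w k = 0.
Proof.
move=> a0 wr; pose s := [seq c + a *+ k | k <- iota 0 (size Delta).+2].
have us : uniq s.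
  rewrite map_inj_uniq ?iota_uniq // => i j /addrI/eqP.
  rewrite -!scaler_nat -subr_eq0 -scalerBl scaler_eq0 (negPf a0) orbF subr_eq0.
  by rewrite eqr_nat => /eqP.
have [/allP sD|/allPn[d /mapP[k _ ->]]] := boolP (all (mem (0 :: Delta)) s).
  by have := uniq_leq_size us sD; rewrite size_map size_iota /= ltnn.
rewrite inE negb_or => /andP[d0 dD]; exists k; apply/eqP.
by apply: contraNT dD => w0; apply: rootspace_mem (wr k) w0 d0.
Qed.

(** Let E, T, F be the sl2-triple of a, and suppose that E kills the vector v of
    weight b. Being of highest weight, v has b(T) >= 0, so the vector u of
    weight a + b has positive weight b(T) + 2 for T. As F maps u to a multiple
    of v, which E kills, a computation in sl2 shows that F E^(k+1) u is a
    nonzero multiple of E^k u for all k, and the string of u never ends. *)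
Lemma root_bracket_neq0 a b :
  a \in Delta -> b \in Delta -> a + b \in Delta -> br (rvec a) (rvec b) != 0.
Proof.
move=> aD bD abD; apply/eqP => Ev0.
have [T [F [Fna EF aT]]] := root_sl2 aD.
set E := rvec a in Ev0 EF; set v := rvec b in Ev0; set u := rvec (a + b).
have a0 := root_neq0 aD; have na0 : - a != 0 by rewrite oppr_eq0.
have brT d x : x \in rootspace d -> br (vsval T) x = d T *: x.
  by move=> /(rootspaceP _ _ br_lie).
have mulrnT (c : dual h) k : (c *+ k) T = k%:R * c T.
  by rewrite -scaler_nat scale_lfunE.
have sr k : iter k (br F) v \in rootspace (b + (- a) *+ k).
  elim: k => [|k IH] /=; first by rewrite addr0 rvec_mem.
  by rewrite mulrS addrCA rootspace_br.
have Ev k : br E (iter k.+1 (br F) v) = (k.+1%:R * (b T - k%:R)) *: iter k (br F) v.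
  elim: k => [|k IH].
    by rewrite /= br_derivation // EF Ev0 br0r addr0 (brT b) ?rvec_mem // mul1r subr0.
  rewrite [iter k.+2 _ _]/= -[br F (iter k _ _)]/(iter k.+1 (br F) v).
  rewrite br_derivation // EF IH brZr -[br F (iter k _ _)]/(iter k.+1 (br F) v).
  rewrite (brT _ _ (sr k.+1)) -scalerDl add_lfunE mulrnT opp_lfunE aT.
  congr (_ *: _); rewrite -!natr1; ring.
have bT0 : 0 <= b T.
  have [k /eqP k0] := no_infinite_string na0 sr.
  have ex : exists k, iter k (br F) v == 0 by exists k.
  have [[|m] m0 min] := ex_minnP ex.
    by case/negP: (rvec_neq0 bD).
  have := Ev m; rewrite (eqP m0) br0r => /esym/eqP; rewrite scaler_eq0.
  case/orP => [|vm0]; last by have := min _ vm0; rewrite ltnn.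
  by rewrite mulf_eq0 pnatr_eq0 /= subr_eq0 => /eqP ->; rewrite ler0n.
have [c Fu] : exists c, br F u = c *: v.
  apply/vlineP; rewrite -rootspaceE //.
  by rewrite -{1}(addKr a b) rootspace_br ?rvec_mem.
have ur k : iter k (br E) u \in rootspace (a + b + a *+ k).
  elim: k => [|k IH] /=; first by rewrite addr0 rvec_mem.
  by rewrite mulrS addrCA rootspace_br ?rvec_mem.
have Fu_ k : br F (iter k.+1 (br E) u) =
    - (k.+1%:R * (b T + 2 + k%:R)) *: iter k (br E) u.
  have FE x : br F (br E x) = br E (br F x) - br (vsval T) x.
    by rewrite br_derivation // [br F E]brC EF brNl addrC.
  elim: k => [|k IH].
    rewrite /= FE Fu brZr Ev0 scaler0 sub0r (brT (a + b)) ?rvec_mem //.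
    by rewrite add_lfunE aT addr0 mul1r addrC scaleNr.
  rewrite [iter k.+2 _ _]/= -[br E (iter k _ _)]/(iter k.+1 (br E) u).
  rewrite FE IH brZr -[br E (iter k _ _)]/(iter k.+1 (br E) u).
  rewrite (brT _ _ (ur k.+1)) -scalerBl !add_lfunE mulrnT aT.
  congr (_ *: _); rewrite -!natr1; ring.
have u_neq0 k : iter k (br E) u != 0.
  elim: k => [|k IH]; first exact: rvec_neq0.
  apply: contraNneq IH => u0; have := Fu_ k; rewrite u0 br0r => /esym/eqP.
  rewrite scaler_eq0 => /orP[|//]; rewrite oppr_eq0 mulf_eq0 pnatr_eq0 /=.
  by rewrite gt_eqF // ltr_wpDr ?ler0n // ltr_wpDl.
have [k /eqP] := no_infinite_string a0 ur.
by rewrite (negPf (u_neq0 k)).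
Qed.


(** * The index of a Borel subalgebra from a cascade *)
Lemma mem_rootsum (s : seq (dual h)) a :
  a \in s -> (rootspace a <= \sum_(b <- s) rootspace b)%VS.
Proof.
elim: s => // b s IH; rewrite inE big_cons => /predU1P[->|/IH aS].
  exact: addvSl.
exact: subv_trans aS (addvSr _ _).
Qed.

Lemma rootsum_sub (s : seq (dual h)) (W : {vspace g}) :
  {in s, forall a, (rootspace a <= W)%VS} ->
  (\sum_(b <- s) rootspace b <= W)%VS.
Proof.
elim: s => [|b s IH] sW; first by rewrite big_nil sub0v.
rewrite big_cons subv_add sW ?mem_head // IH // => a aS.
by rewrite sW // inE aS orbT.
Qed.

Lemma rootsumP (s : seq (dual h)) x : uniq s -> {subset s <= Delta} ->
  x \in (\sum_(b <- s) rootspace b)%VS ->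
  exists c : dual h -> R, x = \sum_(a <- s) c a *: rvec a.
Proof.
elim: s x => [|b s IH] x us sD.
  by rewrite big_nil memv0 => /eqP ->; exists (fun=> 0); rewrite big_nil.
rewrite big_cons => /memv_addP[y yb [z zs ->]]; case/andP: us => bs us.
have bD : b \in Delta by rewrite sD ?mem_head.
have sD' : {subset s <= Delta} by move=> a aS; rewrite sD // inE aS orbT.
have [c ->] := IH z us sD' zs.
move: yb; rewrite rootspaceE // => /vlineP[k ->] /=.
exists (fun a => if a == b then k else c a).
rewrite big_cons eqxx; congr (_ + _); rewrite !big_seq; apply: eq_bigr => a aS.
by rewrite ifN //; apply: contraNneq bs => <-.
Qed.

(** Linear forms on h^* are evaluations at elements of h: this produces the
    coroots, and transports constraints on roots to h. *)
Lemma double_dual (F : 'Hom(dual h, R^o)) :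
  exists t : subvs_of h, forall a, a t = F a.
Proof.
pose B := vbasis (fullv : {vspace subvs_of h}).
pose dl i : dual h := linfun (coord B i : subvs_of h -> R^o).
exists (\sum_i F (dl i) *: B`_i) => a.
have dlE i u : dl i u = coord B i u.
  by apply: linfun_linear; apply: coord_is_scalar.
have aE : a = \sum_(i < \dim (fullv : {vspace subvs_of h})) a (B`_i) *: dl i.
  apply/lfunP => u; rewrite sum_lfunE {1}(coord_vbasis (memvf u)) linear_sum.
  by apply: eq_bigr => i _; rewrite scale_lfunE dlE linearZ /= [_ *: _]mulrC.
rewrite linear_sum {2}aE linear_sum; apply: eq_bigr => i _.
by rewrite !linearZ /= [_ *: _]mulrC.
Qed.

(** The subalgebras met along the cascade: hs is the part of h orthogonal to the
    roots already treated, s the set of positive roots orthogonal to them. *)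
Definition bpart (hs : {vspace g}) (s : seq (dual h)) : {vspace g} :=
  (hs + \sum_(a <- s) rootspace a)%VS.

Lemma bpartP hs (s : seq (dual h)) x : uniq s -> {subset s <= Delta} ->
  x \in bpart hs s -> exists2 y, y \in hs &
  exists c : dual h -> R, x = y + \sum_(a <- s) c a *: rvec a.
Proof.
move=> us sD /memv_addP[y yh [z zs ->]]; have [c ->] := rootsumP us sD zs.
by exists y => //; exists c.
Qed.

Lemma rvec_bpart hs (s : seq (dual h)) a : a \in s -> rvec a \in bpart hs s.
Proof.
move=> aS; apply: (subvP (addvSr _ _)); apply: (subvP (mem_rootsum aS)).
exact: rvec_mem.
Qed.

Lemma br_cartan_rvec x a : x \in h -> br x (rvec a) = a (vsproj h x) *: rvec a.
Proof. by move=> xh; rewrite -{1}(vsprojK xh) br_h_rvec. Qed.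

Lemma br_rootsum (s1 s2 : seq (dual h)) (W : {vspace g}) x y :
  uniq s1 -> {subset s1 <= Delta} -> uniq s2 -> {subset s2 <= Delta} ->
  {in s1 & s2, forall a b, br (rvec a) (rvec b) \in W} ->
  x \in (\sum_(a <- s1) rootspace a)%VS ->
  y \in (\sum_(a <- s2) rootspace a)%VS -> br x y \in W.
Proof.
move=> u1 D1 u2 D2 abW /(rootsumP u1 D1)[c ->] /(rootsumP u2 D2)[c' ->].
rewrite br_suml big_seq; apply: memv_suml => a a1.
rewrite br_sumr big_seq; apply: memv_suml => b b2.
by rewrite brZl brZr !memvZ // abW.
Qed.

Section PositivePart.
Variables (hs : {vspace g}) (s : seq (dual h)) (H0 : subvs_of h).
Hypotheses (hs_h : (hs <= h)%VS) (s_uniq : uniq s) (s_D : {subset s <= Delta}).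
Hypothesis s_pos : {in s, forall a, 0 < a H0}.
Hypothesis s_add : {in s &, forall a b, a + b \in Delta -> a + b \in s}.

Lemma pos_add_neq0 a b : a \in s -> b \in s -> a + b != 0.
Proof.
move=> aS bS; apply/eqP => ab0.
have : 0 < (a + b) H0 by rewrite add_lfunE addr_gt0 ?s_pos.
by rewrite ab0 zero_lfunE ltxx.
Qed.

Lemma br_rvec_stage (W : {vspace g}) a b : a \in s -> b \in s ->
  (a + b \in s -> (rootspace (a + b)%R <= W)%VS) -> br (rvec a) (rvec b) \in W.
Proof.
move=> aS bS abW; have [abD|abD] := boolP (a + b \in Delta); last first.
  by rewrite (rvec_br_eq0 _ abD) ?mem0v ?pos_add_neq0.
by apply: (subvP (abW (s_add aS bS abD))); apply: rootspace_br; apply: rvec_mem.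
Qed.

Lemma bpart_subalgebra : subalgebra br (bpart hs s).
Proof.
move=> x y /memv_addP[x1 /(subvP hs_h) x1h [x2 x2s ->]].
move=> /memv_addP[y1 /(subvP hs_h) y1h [y2 y2s ->]].
have hr z w : z \in h -> w \in (\sum_(a <- s) rootspace a)%VS ->
    br z w \in bpart hs s.
  move=> zh /(rootsumP s_uniq s_D)[c ->]; rewrite br_sumr big_seq.
  apply: memv_suml => a aS; rewrite brZr br_cartan_rvec // !memvZ //.
  exact: rvec_bpart.
rewrite brDl !brDr cartan_abelian // add0r; apply: memvD; first exact: hr.
apply: memvD; first by rewrite brC memvN hr.
apply: br_rootsum x2s y2s => // a b aS bS; apply: br_rvec_stage => // abS.
exact: subv_trans (mem_rootsum abS) (addvSr _ _).
Qed.

End PositivePart.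

(** One step of the cascade: b is its first member and t the coroot of b, so
    that ad t is the grading that cuts out the Heisenberg ideal of b. *)
Section Stage.
Variables (hs : {vspace g}) (s : seq (dual h)) (H0 : subvs_of h).
Hypotheses (hs_h : (hs <= h)%VS) (s_uniq : uniq s) (s_D : {subset s <= Delta}).
Hypothesis s_pos : {in s, forall a, 0 < a H0}.
Hypothesis s_add : {in s &, forall a b, a + b \in Delta -> a + b \in s}.

Let pos_add_neq0 := pos_add_neq0 s_pos.
Let br_rvec_stage := br_rvec_stage s_pos s_add.
Variables (b : dual h) (t : subvs_of h).
Hypotheses (bS : b \in s) (t_hs : vsval t \in hs) (bt : b t = 2).
Hypothesis s_grade : {in s, forall a,
  [\/ a = b, a t = 0 | a t = 1 /\ b - a \in s]}.

Let s0 := [seq a : dual h <- s | a t == 0].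
Let s1 := [seq a : dual h <- s | a t == 1].
Let hs0 := (hs :&: lker (root_on b))%VS.

Lemma grade2 a : a \in s -> a t = 2 -> a = b.
Proof.
move=> aS at2; have [//|a0|[a1 _]] := s_grade aS.
  by have := eqr_nat R 2 0; rewrite -at2 a0 eqxx.
by have := eqr_nat R 2 1; rewrite -at2 a1 eqxx.
Qed.

Lemma grade_le2 a : a \in s -> a t <= 2.
Proof.
by move=> aS; have [->|->|[-> _]] := s_grade aS; rewrite ?bt // ?ler0n ?ler1n.
Qed.

Let s0S a : a \in s0 -> a \in s. Proof. by rewrite mem_filter => /andP[]. Qed.
Let s1S a : a \in s1 -> a \in s. Proof. by rewrite mem_filter => /andP[]. Qed.
Let s0t a : a \in s0 -> a t = 0. Proof. by rewrite mem_filter => /andP[/eqP]. Qed.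
Let s1t a : a \in s1 -> a t = 1. Proof. by rewrite mem_filter => /andP[/eqP]. Qed.

Lemma stage_hs : hs = (<[vsval t]> + hs0)%VS.
Proof.
apply/eqP; rewrite eqEsubv subv_add capvSl -memvE t_hs !andbT.
apply/subvP => y yhs; have yh := subvP hs_h _ yhs.
rewrite -[y](subrK ((b (vsproj h y) / 2) *: vsval t)) addrC.
apply: memv_add; first by rewrite memvZ ?memv_line.
rewrite memv_cap memvB ?memvZ //= memv_ker root_onE; apply/eqP.
rewrite linearB linearZ /= vsvalK linearB linearZ /= bt.
by rewrite [_ *: _]divfK ?subrr ?pnatr_eq0.
Qed.

Lemma stage_dim : \dim hs = (\dim hs0).+1.
Proof.
rewrite -(limg_ker_dim (root_on b) hs) -addn1; congr (_ + _)%N.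
apply/eqP; rewrite eqn_leq; apply/andP; split.
  by rewrite (leq_trans (dimvS (subvf _))) // dimvf.
rewrite lt0n dimv_eq0; apply/eqP => i0.
have : root_on b (vsval t) \in (root_on b @: hs)%VS by apply: memv_img.
rewrite i0 memv0 root_onE vsvalK bt => /eqP/eqP.
by rewrite (pnatr_eq0 R 2).
Qed.

Let s0_D : {subset s0 <= Delta}. Proof. by move=> a /s0S/s_D. Qed.
Let s1_D : {subset s1 <= Delta}. Proof. by move=> a /s1S/s_D. Qed.
Let s0_uniq : uniq s0. Proof. exact: filter_uniq. Qed.
Let s1_uniq : uniq s1. Proof. exact: filter_uniq. Qed.

Lemma stage_sum : bpart hs s = (<[rvec b]> + <[vsval t]> +
  \sum_(a <- s1) rootspace a + bpart hs0 s0)%VS.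
Proof.
set W := (RHS); have bW : (<[rvec b]> <= W)%VS by rewrite /W -!addvA addvSl.
have tW : (<[vsval t]> <= W)%VS.
  by rewrite /W -!addvA; apply: subv_trans (addvSr _ _); apply: addvSl.
have s1W : (\sum_(a <- s1) rootspace a <= W)%VS.
  by rewrite /W -addvA; apply: subv_trans (addvSr _ _); apply: addvSl.
have hs0W : (hs0 <= W)%VS.
  by apply: subv_trans (addvSr _ _); apply: addvSl.
have s0W : (\sum_(a <- s0) rootspace a <= W)%VS.
  by apply: subv_trans (addvSr _ _); apply: addvSr.
apply/eqP; rewrite eqEsubv; apply/andP; split.
  rewrite subv_add stage_hs subv_add tW hs0W; apply: rootsum_sub => a aS.
  have [->|a0|[a1 _]] := s_grade aS; first by rewrite rootspaceE ?s_D.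
    by apply: subv_trans s0W; apply: mem_rootsum; rewrite mem_filter a0 eqxx.
  by apply: subv_trans s1W; apply: mem_rootsum; rewrite mem_filter a1 eqxx.
have sS : {in s, forall a, (rootspace a <= bpart hs s)%VS}.
  by move=> a aS; apply: subv_trans (mem_rootsum aS) (addvSr _ _).
rewrite /W !subv_add -!memvE rvec_bpart // (subvP (addvSl _ _)) //=.
rewrite rootsum_sub; last by move=> a /s1S; apply: sS.
rewrite (subv_trans (capvSl _ _) (addvSl _ _)) rootsum_sub // => a /s0S.
exact: sS.
Qed.

Lemma stage_pos0 : {in s0, forall a, 0 < a H0}.
Proof. by move=> a /s0S/s_pos. Qed.

Lemma stage_add0 : {in s0 &, forall a c, a + c \in Delta -> a + c \in s0}.
Proof.
move=> a c a0 c0 acD; rewrite mem_filter add_lfunE !s0t // addr0 eqxx.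
by rewrite s_add ?s0S.
Qed.

Let hs0_h : (hs0 <= h)%VS. Proof. exact: subv_trans (capvSl _ _) hs_h. Qed.

(** The structure constant of the pair (b - a, a), which gives the dual basis of
    the degree 1 part. *)
Let brc a := (coord [tuple rvec b] ord0 (br (rvec (b - a)) (rvec a)) : R).

Let brcE a : br (rvec (b - a)) (rvec a) = brc a *: rvec b.
Proof.
have : br (rvec (b - a)) (rvec a) \in <<[tuple rvec b]>>%VS.
  rewrite span_seq1 -rootspaceE ?s_D // -{2}(subrK a b).
  by rewrite rootspace_br ?rvec_mem.
by move=> /coord_span {1}->; rewrite big_ord1.
Qed.

(** The symplectic form is nondegenerate because b - a + a' is a root of
    degree 2 only for a' = a, and because brackets of root vectors do not vanish
    when the sum is a root. *)
Lemma stage_index m :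
  has_index br (bpart hs0 s0) m -> has_index br (bpart hs s) m.
Proof.
have e0 := rvec_neq0 (s_D bS).
have s1b a : a \in s1 -> b - a \in s1.
  move=> as1; have [ab|a0|[_ baS]] := s_grade (s1S as1).
  - by have := s1t as1; rewrite ab bt => /eqP; rewrite (eqr_nat R 2 1).
  - by have := s1t as1; rewrite a0 => /eqP; rewrite (eqr_nat R 0 1).
  rewrite mem_filter baS andbT add_lfunE opp_lfunE bt s1t //.
  by apply/eqP; ring.
have bh x : x \in hs0 -> b (vsproj h x) = 0.
  by rewrite memv_cap memv_ker root_onE => /andP[_ /eqP].
pose p a := (brc a)^-1 *: rvec (b - a).
apply: (has_index_reduction br_lie (e := rvec b) (t := vsval t)
  (V := (\sum_(a <- s1) rootspace a)%VS) (s := s1) (p := p) (q := rvec)) => //.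
- exact: (bpart_subalgebra hs_h s_uniq s_D s_pos s_add).
- apply: (bpart_subalgebra hs0_h s0_uniq s0_D stage_pos0 stage_add0).
- exact: stage_sum.
- by rewrite br_h_rvec bt.
- move=> v /(rootsumP s1_uniq s1_D)[c ->]; rewrite br_sumr !big_seq.
  by apply: eq_bigr => a aS; rewrite brZr br_h_rvec s1t // scale1r.
- move=> x /(bpartP s0_uniq s0_D)[y yh [c ->]].
  rewrite brDr cartan_abelian ?subvsP ?(subvP hs0_h) // add0r br_sumr big_seq.
  by rewrite big1 // => a aS; rewrite brZr br_h_rvec s0t // scale0r scaler0.
- move=> v /(rootsumP s1_uniq s1_D)[c ->]; rewrite br_sumr big_seq big1 // => a aS.
  rewrite brZr rvec_br_eq0 ?scaler0 ?(pos_add_neq0 bS (s1S aS)) //.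
  apply/negP => abD; have := grade_le2 (s_add bS (s1S aS) abD).
  by rewrite add_lfunE bt s1t // gerDl ler10.
- move=> x /(bpartP s0_uniq s0_D)[y yh [c ->]].
  rewrite brDr brC br_cartan_rvec ?(subvP hs0_h) // bh // scale0r oppr0 add0r.
  rewrite br_sumr big_seq big1 // => a aS.
  rewrite brZr rvec_br_eq0 ?scaler0 ?(pos_add_neq0 bS (s0S aS)) //.
  apply/negP => abD; have := grade2 (s_add bS (s0S aS) abD).
  rewrite add_lfunE bt s0t // addr0 => /(_ erefl) /eqP.
  by rewrite -subr_eq0 addrC addKr (negPf (root_neq0 (s0_D aS))).
- move=> v w vV wV; apply: br_rootsum vV wV => // a c a1 c1.
  apply: (br_rvec_stage (s1S a1) (s1S c1)) => acS; rewrite -rootspaceE ?s_D //.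
  by rewrite (grade2 acS) // add_lfunE !s1t.
- move=> x v /memv_addP[y yh [z zs ->]] vV; rewrite brDl; apply: memvD.
    move: vV => /(rootsumP s1_uniq s1_D)[c ->]; rewrite br_sumr big_seq.
    apply: memv_suml => a aS; rewrite brZr br_cartan_rvec ?(subvP hs0_h) //.
    by rewrite !memvZ // (subvP (mem_rootsum aS)) // rvec_mem.
  apply: br_rootsum zs vV => // a c a0 c1.
  apply: (br_rvec_stage (s0S a0) (s1S c1)) => acS.
  by apply: mem_rootsum; rewrite mem_filter acS add_lfunE s0t // s1t // add0r eqxx.
- move=> a aS; rewrite memvZ // (subvP (mem_rootsum (s1b a aS))) //.
  exact: rvec_mem.
move=> w /(rootsumP s1_uniq s1_D)[c wE]; exists c; split=> // a aS.
have brc0 : brc a != 0.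
  apply: contraTneq isT => brc0; have := brcE a; rewrite brc0 scale0r => /eqP.
  by rewrite (negPf (root_bracket_neq0 _ _ _)) ?s_D ?subrK // s1S // s1b.
rewrite wE br_sumr (bigD1_seq a) //= brZr /p brZl brcE (scalerA (brc a)^-1) mulVf //.
rewrite scale1r big_seq_cond big1 ?addr0 // => a' /andP[a'S a'a].
rewrite brZr brZl rvec_br_eq0 ?scaler0 ?(pos_add_neq0 (s1S (s1b _ aS)) (s1S a'S)) //.
apply/negP => abD; have := grade2 (s_add (s1S (s1b _ aS)) (s1S a'S) abD).
rewrite !add_lfunE opp_lfunE bt !s1t // => eq_b; case/eqP: a'a.
by apply: (addrI (b - a)); rewrite subrK; apply: eq_b; ring.
Qed.

End Stage.

Section Coordinates.
Variables (n : nat) (phi : 'Hom(dual h, 'rV[R]_n)).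
Hypothesis phi_inj : lker phi = 0%VS.

Lemma phiI : injective phi.
Proof. by apply/lker0P; rewrite phi_inj. Qed.

Lemma phi_dotp_neq0 a : a != 0 -> dotp (phi a) (phi a) != 0.
Proof.
move=> a0; rewrite gt_eqF // dotp_gt0 // -(linear0 phi).
by apply: contraNneq a0 => /phiI ->.
Qed.

(** Each member of the cascade lowers the dimension of the Cartan part by one
    and keeps the index; at the end an abelian algebra remains, whose index is
    its dimension. *)
Lemma cascade_has_index (H0 : subvs_of h) K (hs : {vspace g}) (s : seq (dual h)) :
  (hs <= h)%VS -> uniq s -> {subset s <= Delta} ->
  {in s, forall a, 0 < a H0} ->
  {in s &, forall a b, a + b \in Delta -> a + b \in s} ->
  {in s, forall a, exists t : subvs_of h, vsval t \in hs /\ forall c : dual h,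
    c t = 2 * dotp (phi c) (phi a) / dotp (phi a) (phi a)} ->
  cascade (fun v => exists2 a, a \in s & v = phi a) K ->
  exists2 m, \dim hs = (m + size K)%N & has_index br (bpart hs s) m.
Proof.
elim: K hs s => [|v0 K IH] hs s hs_h us sD s_pos s_add s_cor /=.
  move=> s0; exists (\dim hs); first by rewrite addn0.
  have -> : s = [::].
    case: s s0 {us sD s_pos s_add s_cor} => // a s /(_ (phi a)) []; exists a => //.
    exact: mem_head.
  rewrite /bpart big_nil addv0; apply: has_index_abelian => // x y xh yh.
  by rewrite cartan_abelian // (subvP hs_h).
move=> [[b bS ->] s_grade {v0} casc].
have [t [t_hs tE]] := s_cor b bS.
have bb := phi_dotp_neq0 (root_neq0 (sD _ bS)).
have bt : b t = 2 by rewrite tE mulfK.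
have a0E a : (a t == 0) = (dotp (phi a) (phi b) == 0).
  by rewrite tE !mulf_eq0 invr_eq0 (negPf bb) orbF pnatr_eq0.
have s_gradet : {in s, forall a, [\/ a = b, a t = 0 | a t = 1 /\ b - a \in s]}.
  move=> a aS; have [|/phiI|a0|[a1 [c cS cE]]] := s_grade (phi a).
  - by exists a.
  - by move=> ->; apply: Or31.
  - by apply/Or32/eqP; rewrite a0E a0.
  apply: Or33; rewrite tE a1 divff //; split=> //.
  by rewrite (_ : b - a = c) //; apply: phiI; rewrite linearB.
rewrite (stage_dim t_hs bt).
have [|||||||m dimE idx] := IH (hs :&: lker (root_on b))%VS
    [seq a : dual h <- s | a t == 0].
- exact: subv_trans (capvSl _ _) hs_h.
- exact: filter_uniq.
- by move=> a; rewrite mem_filter => /andP[_ /sD].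
- by apply: stage_pos0.
- by apply: stage_add0.
- move=> a; rewrite mem_filter a0E => /andP[/eqP ab aS].
  have [u [u_hs uE]] := s_cor a aS; exists u; split=> //.
  rewrite memv_cap u_hs memv_ker root_onE vsvalK uE; apply/eqP.
  by rewrite [dotp (phi b) _]dotpC ab mulr0 mul0r.
- apply: cascade_ext casc => v; split=> [[[a aS ->] /eqP a0]|[a]].
    by exists a; rewrite // mem_filter a0E a0.
  rewrite mem_filter a0E => /andP[/eqP a0 aS ->]; split=> //.
  by exists a.
exists m; first by rewrite dimE addnS.
exact: (stage_index hs_h us sD s_pos s_add bS t_hs bt s_gradet idx).
Qed.

(** Evaluation at the element of h that defines the positive roots becomes a
    scalar product in coordinates. *)
Lemma coords_functional (u : subvs_of h) :
  exists l : 'rV[R]_n, forall a, dotp l (phi a) = a u.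
Proof.
exists (\row_i ((phi^-1)%VF (delta_mx 0 i)) u) => a.
have phiK : (phi^-1)%VF (phi a) = a by apply: lker0_lfunK; rewrite phi_inj.
rewrite -{2}phiK {2}(row_sum_delta (phi a)) linear_sum sum_lfunE.
by apply: eq_bigr => i _; rewrite mxE linearZ scale_lfunE [_ *: _]mulrC.
Qed.

(** The index of the Borel subalgebra is the rank minus the length of the
    cascade. The cascade is only asked to exist for every choice l of positive
    roots, which is what the study of root systems in coordinates gives. *)
Lemma borel_index_cascade (Delta_plus : seq (dual h)) (rt : 'rV[R]_n -> Prop) m :
  positive_system Delta Delta_plus ->
  (forall v, rt v <-> exists2 a, a \in Delta & v = phi a) ->
  (forall l, (forall v, rt v -> dotp l v != 0) ->
     exists2 K, cascade (fun v => rt v /\ 0 < dotp l v) K & size K = m) ->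
  \dim h = (lie_index (@sub_bracket R g br (borel br Delta_plus)) + m)%N.
Proof.
move=> [H0 [H0_reg plusE]] rtE casc.
have [l lE] := coords_functional H0.
have [v /rtE[a aD ->]|K cK sK] := casc l; first by rewrite lE H0_reg.
pose s := [seq a : dual h <- Delta | 0 < a H0].
have sE a : (a \in s) = (a \in Delta_plus) by rewrite mem_filter plusE andbC.
have borelE : borel br Delta_plus = bpart h s.
  rewrite /borel /bpart; congr (_ + _)%VS; apply/eqP; rewrite eqEsubv.
  by apply/andP; split; apply: rootsum_sub => a aS; apply: mem_rootsum;
    rewrite ?sE // -sE.
have s_pos : {in s, forall a, 0 < a H0}.
  by move=> a; rewrite mem_filter => /andP[].
have sD : {subset s <= Delta} by move=> a; rewrite mem_filter => /andP[].
have s_add : {in s &, forall a b, a + b \in Delta -> a + b \in s}.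
  by move=> a b aS bS abD; rewrite mem_filter abD add_lfunE addr_gt0 ?s_pos.
have us : uniq s by apply: filter_uniq; case: Delta_roots.
have [||d dimE idx] := cascade_has_index (K := K) (subvv h) us sD s_pos s_add.
- move=> a aS.
  pose F : 'Hom(dual h, R^o) := linfun (fun c : dual h =>
    (2 * dotp (phi c) (phi a) / dotp (phi a) (phi a) : R^o)).
  have FE c : F c = 2 * dotp (phi c) (phi a) / dotp (phi a) (phi a).
    apply: linfun_linear => k u v; rewrite linearP dotpDl dotpZl.
    by rewrite -[_ *: _]/(_ * _); ring.
  by have [t tE] := double_dual F; exists t; rewrite subvsP; split=> // c; rewrite tE.
- apply: cascade_ext cK => v; split=> [[/rtE[a aD ->]]|[a]].
    by rewrite lE => a0; exists a; rewrite // mem_filter a0.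
  move=> aS ->; rewrite lE s_pos //; split=> //; apply/rtE.
  by exists a; rewrite ?sD.
by rewrite borelE (lie_index_has_index idx) dimE sK.
Qed.

Lemma dim_limg_phi : \dim (limg phi) = \dim h.
Proof. by rewrite limg_dim_eq ?capfv // dimvf /dim /= muln1. Qed.

Lemma rank_ge (S : seq 'rV[R]_n) :
  (forall i, delta_mx 0 i \in (limg phi + <<S>>)%VS) -> (n <= \dim h + size S)%N.
Proof.
move=> full; rewrite -dim_limg_phi.
have dimn : \dim (limg phi + <<S>>)%VS = n.
  rewrite (_ : (_ + _)%VS = fullv) ?dimvf /dim /= ?mul1n //.
  apply/vspaceP => v; rewrite memvf (row_sum_delta v).
  by apply: memv_suml => i _; rewrite memvZ.
rewrite -{1}dimn; apply: leq_trans (dimv_add_leqif _ _) _.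
by rewrite leq_add2l dim_span.
Qed.

(** A vector l orthogonal to all roots is orthogonal to the image of phi,
    because the linear form it defines on h^* is evaluation at an element of h
    on which all roots vanish. *)
Lemma rank_le (S : seq 'rV[R]_n) : free S ->
  {in S, forall l, {in Delta, forall a, dotp l (phi a) = 0}} ->
  (\dim h + size S <= n)%N.
Proof.
move=> /eqP <- S0; rewrite -dim_limg_phi.
have orth l a : l \in S -> dotp l (phi a) = 0.
  move=> lS; pose F : 'Hom(dual h, R^o) := linfun (fun c : dual h =>
    (dotp l (phi c) : R^o)).
  have FE c : F c = dotp l (phi c).
    by apply: linfun_linear => k u v; rewrite linearP dotpDr dotpZr.
  have [t tE] := double_dual F; rewrite -FE -tE (@roots_separate t) ?linear0 //.
  by move=> c cD; rewrite tE FE S0.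
rewrite -dimv_disjoint_sum.
  by rewrite (leq_trans (dimvS (subvf _))) // dimvf /dim /= mul1n.
apply/eqP; rewrite -subv0; apply/subvP => v; rewrite memv_cap memv0.
move=> /andP[/memv_imgP[a _ ->] vS]; apply: contraTT isT => v0.
have := dotp_gt0 v0; suff -> : dotp (phi a) (phi a) = 0 by rewrite ltxx.
have := coord_span (X := in_tuple S) vS => {1}->.
rewrite /dotp; transitivity (\sum_i coord (in_tuple S) i (phi a) * dotp S`_i (phi a)).
  transitivity (dotp (\sum_i coord (in_tuple S) i (phi a) *: S`_i) (phi a)) => //.
  elim/big_rec2: _ => [|i x y _ <-]; last by rewrite dotpDl dotpZl.
  by rewrite dotpC dotp0r.
by rewrite big1 // => i _; rewrite orth ?mulr0 // mem_nth.
Qed.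

End Coordinates.

End SplitSimple.

(** * Cascades in orthonormal coordinates *)

(** The positive roots of the classical types are described by an orthonormal
    family eps ordered by mu: a root is positive when its term of larger mu has
    the right sign. A subset S of the indices selects the subsystem that is
    left in the course of the cascade. *)
Section OrthonormalCascades.
Variables (R : realFieldType) (n : nat).
Variables (eps : 'I_n -> 'rV[R]_n) (mu : 'I_n -> R).
Hypothesis dotp_eps : forall i j, dotp (eps i) (eps j) = (i == j)%:R.
Hypothesis mu_inj : injective mu.
Implicit Types (S : {set 'I_n}) (v : 'rV[R]_n).

Lemma exists_max S : (0 < #|S|)%N ->
  exists2 i, i \in S & forall k, k \in S -> k != i -> mu k < mu i.
Proof.
rewrite card_gt0 => /set0Pn[i0 i0S].
case: (arg_maxP mu i0S) => i iS max; exists i => // k kS ki.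
by rewrite lt_neqAle (inj_eq mu_inj) ki; exact: max.
Qed.

Lemma exists_min S : (0 < #|S|)%N ->
  exists2 i, i \in S & forall k, k \in S -> k != i -> mu i < mu k.
Proof.
rewrite card_gt0 => /set0Pn[i0 i0S].
case: (arg_minP mu i0S) => i iS min; exists i => // k kS ki.
by rewrite lt_neqAle (inj_eq mu_inj) eq_sym ki; exact: min.
Qed.

Lemma card_le1_lt S i j : (#|S| <= 1)%N -> i \in S -> j \in S -> ~ mu i < mu j.
Proof. by move=> /card_le1_eqP S1 iS jS; rewrite (S1 i j) // ltxx. Qed.

Lemma cardsD2 S i j : i \in S -> j \in S :\ i -> #|S| = #|S :\ i :\ j|.+2.
Proof. by move=> iS jS; rewrite (cardsD1 i S) iS (cardsD1 j (S :\ i)) jS. Qed.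

Definition posA S v := exists i j, [/\ i \in S, j \in S, mu j < mu i & v = eps i - eps j].

(** The highest root is eps i - eps j with mu i maximal and mu j minimal, and
    its orthogonal is the same system on the other indices. *)
Lemma cascadeA S : exists2 K, cascade (posA S) K & size K = (#|S| %/ 2)%N.
Proof.
have [m] := ubnP #|S|; elim: m S => // m IH S; rewrite ltnS => leSm.
have [S1|S1] := leqP #|S| 1.
  exists [::]; last by move: S1; case: #|S| => [|[]].
  by move=> v [i [j [iS jS ij _]]]; apply: (card_le1_lt S1 jS iS).
have [i iS max] := exists_max (ltnW S1).
have [|j jS min] := @exists_min (S :\ i).
  by move: S1; rewrite (cardsD1 i S) iS.
have cS := cardsD2 iS jS; set S' := S :\ i :\ j in cS.
move: (jS); rewrite !inE => /andP[ji jS0].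
have minS k : k \in S -> k != j -> mu j < mu k.
  by move=> kS kj; have [->|ki] := eqVneq k i; [exact: max|rewrite min // !inE ki].
have [|K cK sK] := IH S'; first by rewrite (leq_trans _ leSm) // cS.
pose b := eps i - eps j.
have dotb k l : dotp (eps k - eps l) b =
    (k == i)%:R - (k == j)%:R - ((l == i)%:R - (l == j)%:R).
  by rewrite dotpBl !dotpBr !dotp_eps.
have ord k l : k \in S -> l \in S -> mu l < mu k -> (k == j = false) * (l == i = false).
  move=> kS lS lk; split; apply/negP => /eqP E; move: lk; rewrite E => lk.
    have [lj|lj] := eqVneq l j; first by move: lk; rewrite lj ltxx.
    by have := lt_trans lk (minS l lS lj); rewrite ltxx.
  have [ki|ki] := eqVneq k i; first by move: lk; rewrite ki ltxx.
  by have := lt_trans lk (max k kS ki); rewrite ltxx.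
exists (b :: K); last by rewrite /= sK cS -[#|S'|.+2]addn2 divnDr // addn1.
split.
- by exists i, j; rewrite max.
- move=> v [k [l [kS lS lk ->]]]; have [kj li] := ord k l kS lS lk.
  rewrite dotb kj li; case: eqVneq => [->|ki]; case: eqVneq => [->|lj].
  + exact: Or31.
  + apply: Or33; rewrite dotb !eqxx [i == j]eq_sym (negPf ji).
    split; first by ring.
    by exists l, j; rewrite minS // /b opprB addrC subrKA.
  + apply: Or33; rewrite dotb !eqxx [i == j]eq_sym (negPf ji).
    split; first by ring.
    by exists i, k; rewrite max // /b opprB addrA subrK.
  + by apply: Or32; ring.
apply: cascade_ext cK => v; split.
  move=> [k [l [kS lS lk ->]]].
  move: kS lS; rewrite !inE => /and3P[kj ki kS] /and3P[lj li lS]; split.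
    by exists k, l.
  by rewrite dotb (negPf kj) (negPf ki) (negPf lj) (negPf li); ring.
move=> [[k [l [kS lS lk ->]]]]; have [kj li] := ord k l kS lS lk.
rewrite dotb kj li => d0; exists k, l; rewrite !inE kS lS kj li lk; move: d0.
case: eqVneq => _; case: eqVneq => _ //= /eqP.
- by rewrite (_ : _ - _ = 2) ?pnatr_eq0 //; ring.
- by rewrite (_ : _ - _ = 1) ?oner_eq0 //; ring.
- by rewrite (_ : _ - _ = 1) ?oner_eq0 //; ring.
Qed.

Definition posD S v := exists k l (s : bool),
  [/\ k \in S, l \in S, mu l < mu k & v = eps k + (-1) ^+ s *: eps l].
Definition posBD (short : bool) S v :=
  (short /\ exists2 k, k \in S & v = eps k) \/ posD S v.
Definition posC S v := (exists2 k, k \in S & v = 2 *: eps k) \/ posD S v.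

Lemma dotp_epsD k l (s : bool) u :
  dotp (eps k + (-1) ^+ s *: eps l) u = dotp (eps k) u + (-1) ^+ s * dotp (eps l) u.
Proof. by rewrite dotpDl dotpZl. Qed.

(** The highest root is twice eps i with mu i maximal; it removes a single
    index. *)
Lemma cascadeC S : exists2 K, cascade (posC S) K & size K = #|S|.
Proof.
have [m] := ubnP #|S|; elim: m S => // m IH S; rewrite ltnS => leSm.
have [S0|S0] := posnP #|S|.
  exists [::]; last by rewrite S0.
  have noS k : k \in S -> False by rewrite (cards0_eq S0) inE.
  by move=> v [[k /noS]|[k [l [s [/noS]]]]].
have [i iS max] := exists_max S0.
have cS : #|S| = #|S :\ i|.+1 by rewrite (cardsD1 i) iS.
have [|K cK sK] := IH (S :\ i); first by rewrite -cS.
pose b := 2 *: eps i.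
have dotb k : dotp (eps k) b = 2 * (k == i)%:R by rewrite dotpZr dotp_eps.
have ord k l : k \in S -> mu l < mu k -> l == i = false.
  move=> kS lk; apply/negP => /eqP E; move: lk; rewrite E => lk.
  have [ki|ki] := eqVneq k i; first by move: lk; rewrite ki ltxx.
  by have := lt_trans lk (max k kS ki); rewrite ltxx.
exists (b :: K); last by rewrite /= sK cS.
split.
- by left; exists i.
- move=> v [[k kS ->]|[k [l [s [kS lS lk ->]]]]].
    have [->|ki] := eqVneq k i; first exact: Or31.
    by apply: Or32; rewrite dotpZl dotb (negPf ki) !mulr0.
  have li := ord k l kS lk.
  rewrite dotp_epsD !dotb li mulr0 mulr0 addr0.
  have [ki|ki] := eqVneq k i; last by apply: Or32; rewrite mulr0.
  apply: Or33; rewrite dotpZl dotb eqxx; split; first by ring.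
  right; exists i, l, (~~ s); rewrite iS lS -ki lk; split=> //.
  rewrite /b -ki scaler_nat mulr2n opprD addrA addrK.
  by case: s; rewrite /= ?expr0 ?expr1 ?scaleN1r ?scale1r ?opprK.
apply: cascade_ext cK => v; split.
  case=> [[k]|[k [l [s [kS lS lk ->]]]]].
    rewrite !inE => /andP[ki kS] ->; split; first by left; exists k.
    by rewrite dotpZl dotb (negPf ki) !mulr0.
  move: kS lS; rewrite !inE => /andP[ki kS] /andP[li lS]; split.
    by right; exists k, l, s.
  by rewrite dotp_epsD !dotb (negPf ki) (negPf li) !mulr0 addr0.
move=> [[[k kS ->]|[k [l [s [kS lS lk ->]]]]]].
  rewrite dotpZl dotb => d0; left; exists k; rewrite // !inE kS andbT.
  by apply: contra_eqN d0 => ->; rewrite mulr1 mulf_neq0 ?pnatr_eq0.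
have li := ord k l kS lk.
rewrite dotp_epsD !dotb li !mulr0 addr0 => d0.
right; exists k, l, s; rewrite !inE kS lS li lk; split=> //; rewrite andbT.
by apply: contra_eqN d0 => ->; rewrite mulr1 pnatr_eq0.
Qed.

(** For the two indices i, j of largest mu, the highest root is eps i + eps j.
    Its orthogonal contains eps i - eps j, which is orthogonal to the rest, so
    two cascade members remove two indices. A last single index carries a root
    only when there are short roots. *)
Lemma cascadeBD short S : exists2 K, cascade (posBD short S) K &
  size K = (if short then #|S| else #|S| - odd #|S|)%N.
Proof.
have [m] := ubnP #|S|; elim: m S => // m IH S; rewrite ltnS => leSm.
have [S1|S1] := leqP #|S| 1.
  have noD v : ~ posD S v.
    by move=> [k [l [s [kS lS lk _]]]]; apply: (card_le1_lt S1 lS kS).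
  have [S0|S0] := posnP #|S|.
    exists [::]; last by rewrite S0; case: (short).
    by move=> v [[_ [k]]|/noD//]; rewrite (cards0_eq S0) inE.
  have cS : #|S| = 1%N by apply/eqP; rewrite eqn_leq S1.
  case: short {IH}; last by exists [::]; [move=> v [[]//|/noD] | rewrite cS].
  have /cards1P[i SE] : #|S| == 1%N by rewrite cS.
  have onlyi v : posBD true S v -> v = eps i.
    by move=> [[_ [k]]|/noD//]; rewrite SE inE => /eqP-> ->.
  exists [:: eps i]; last by rewrite cS.
  split.
  - by left; split=> //; exists i; rewrite // SE inE.
  - by move=> v /onlyi; apply: Or31.
  move=> v [/onlyi ->]; rewrite dotp_eps eqxx => /eqP.
  by rewrite oner_eq0.
have [i iS max] := exists_max (ltnW S1).
have [|j jS maxj] := @exists_max (S :\ i).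
  by move: S1; rewrite (cardsD1 i S) iS.
have cS := cardsD2 iS jS; set S' := S :\ i :\ j in cS.
move: (jS); rewrite !inE => /andP[ji jS0].
have [|K cK sK] := IH S'; first by rewrite (leq_trans _ leSm) // cS.
pose b s := eps i + (-1) ^+ nat_of_bool s *: eps j.
have dotb k s : dotp (eps k) (b s) = (k == i)%:R + (-1) ^+ s * (k == j)%:R.
  by rewrite dotpDr dotpZr !dotp_eps.
have bb s : dotp (b s) (b s) = 2.
  rewrite dotp_epsD !dotb !eqxx [i == j]eq_sym (negPf ji).
  by case: s; rewrite /= ?expr0 ?expr1; ring.
have b10 : dotp (b true) (b false) = 0.
  rewrite dotp_epsD !dotb !eqxx [i == j]eq_sym (negPf ji) /= expr0 expr1; ring.
have ordi k l : k \in S -> mu l < mu k -> l == i = false.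
  move=> kS lk; apply/negP => /eqP E; move: lk; rewrite E => lk.
  have [ki|ki] := eqVneq k i; first by move: lk; rewrite ki ltxx.
  by have := lt_trans lk (max k kS ki); rewrite ltxx.
have ordj k l : k \in S -> mu l < mu k -> k != i -> l == j = false.
  move=> kS lk ki; apply/negP => /eqP E; move: lk; rewrite E => lk.
  have [kj|kj] := eqVneq k j; first by move: lk; rewrite kj ltxx.
  by have := lt_trans lk (maxj k _ kj); rewrite !inE ki kS ltxx => /(_ isT).
have bpos s : posBD short S (b s).
  by right; exists i, j, s; rewrite max.
have S'_orth v s : posBD short S' v -> posBD short S v /\ dotp v (b s) = 0.
  case=> [[sh [k]]|[k [l [s' [kS lS lk ->]]]]].
    rewrite !inE => /and3P[kj ki kS] ->; split; first by left; split=> //; exists k.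
    by rewrite dotb (negPf kj) (negPf ki) !(mulr0, addr0).
  move: kS lS; rewrite !inE => /and3P[kj ki kS] /and3P[lj li lS]; split.
    by right; exists k, l, s'.
  by rewrite dotp_epsD !dotb (negPf kj) (negPf ki) (negPf li) (negPf lj) !(mulr0, addr0).
have cases v : posBD short S v ->
  [\/ v = b false, v = b true, posBD short S' v
    | dotp v (b false) = 1 /\ posBD short S (b false - v)].
  case=> [[sh [k kS ->]]|[k [l [s' [kS lS lk ->]]]]].
    have [ki|ki] := eqVneq k i.
      apply: Or44; rewrite dotb ki eqxx [i == j]eq_sym (negPf ji); split.
        by rewrite /= ?expr0; ring.
      by left; split=> //; exists j; rewrite // /b addrAC subrr add0r scale1r.
    have [kj|kj] := eqVneq k j.
      apply: Or44; rewrite dotb kj eqxx (negPf ji) /= expr0; split.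
        by ring.
      by left; split=> //; exists i; rewrite // /b scale1r addrK.
    by apply: Or43; left; split=> //; exists k; rewrite // !inE ki kj.
  have li := ordi k l kS lk; have [ki|ki] := eqVneq k i.
    have [lj|lj] := eqVneq l j; first by rewrite ki lj; case: (s'); [exact: Or42|exact: Or41].
    apply: Or44; rewrite dotp_epsD !dotb ki eqxx li [i == j]eq_sym (negPf ji) (negPf lj).
    split; first by rewrite /= ?expr0; ring.
    right; exists j, l, (~~ s'); split=> //.
      by apply: maxj => //; rewrite !inE li.
    rewrite /b /= scale1r opprD addrACA subrr add0r.
    by case: (s'); rewrite /= ?expr0 ?expr1 ?scaleN1r ?scale1r ?opprK.
  have lj := ordj k l kS lk ki; have [kj|kj] := eqVneq k j.
    apply: Or44; rewrite dotp_epsD !dotb kj eqxx li lj (negPf ji).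
    rewrite /= expr0; split; first by rewrite /= ?expr0; ring.
    right; exists i, l, (~~ s'); split=> //; first by rewrite max ?li.
    rewrite /b /= scale1r opprD addrA addrK.
    by case: (s'); rewrite /= ?expr0 ?expr1 ?scaleN1r ?scale1r ?opprK.
  by apply: Or43; right; exists k, l, s'; rewrite !inE kj ki li lj.
exists (b false :: b true :: K).
  split=> //.
    move=> v /cases[->|->|/(S'_orth v false)[_ ?]|[d1 ?]].
    - exact: Or31.
    - exact: Or32.
    - exact: Or32.
    by apply: Or33; rewrite d1 bb mulr1.
  split=> //.
    move=> v [/cases[->|->|/(S'_orth v true)[_ ?]|[-> _]] d0].
    - by move: d0; rewrite bb => /eqP; rewrite pnatr_eq0.
    - exact: Or31.
    - exact: Or32.
    by move/eqP: d0; rewrite oner_eq0.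
  apply: cascade_ext cK => v; split.
    move=> vS'; have [vS v0] := S'_orth v false vS'.
    by have [_ v1] := S'_orth v true vS'.
  move=> [[/cases[->|->|//|[-> _]] /eqP]].
  - by rewrite bb pnatr_eq0.
  - by move=> _ /eqP; rewrite bb pnatr_eq0.
  by rewrite oner_eq0.
rewrite /= sK cS; case: (short) => //=.
have oS : (odd #|S'| <= #|S'|)%N by case: #|S'| => // k; case: (odd _).
by rewrite negbK subSn ?leqW // subSn.
Qed.

End OrthonormalCascades.

(** * Cascades of the classical root systems *)

Section ClassicalCascades.
Variables (R : realFieldType) (n : nat) (l : 'rV[R]_n).
Local Notation e i := (delta_mx 0 i : 'rV[R]_n).

Lemma dotp_e i j : dotp (e i) (e j) = (i == j)%:R.
Proof. by rewrite dotp_delta mxE eq_sym. Qed.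

Lemma cascade_rootA : (forall v, rootA v -> dotp l v != 0) ->
  exists2 K, cascade (fun v => rootA v /\ 0 < dotp l v) K & size K = (n %/ 2)%N.
Proof.
move=> reg; have inj : injective (fun i => l 0 i).
  move=> i j ij; apply/eqP; apply: contraT => neq_ij.
  have := reg (e i - e j); rewrite dotpBr !dotp_delta ij subrr eqxx.
  by apply; exists i, j.
have [K cK sK] := cascadeA dotp_e inj [set: 'I_n].
exists K; last by rewrite sK cardsT card_ord.
apply: cascade_ext cK => v; split.
  move=> [i [j [_ _ ij ->]]]; rewrite dotpBr !dotp_delta subr_gt0; split=> //.
  exists i, j; split=> //; apply: contraTneq ij => ->.
  by rewrite ltxx.
move=> [[i [j [_ ->]]]]; rewrite dotpBr !dotp_delta subr_gt0 => ij.
by exists i, j; rewrite !inE.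
Qed.

(** The vectors eps i = sgn (l i) e_i and the sizes mu i = |l i| reduce an
    arbitrary positive system to the standard one. *)
Let sgn i := l 0 i < 0.
Let eps i : 'rV[R]_n := (-1) ^+ nat_of_bool (sgn i) *: e i.
Let mu i := `|l 0 i|.

Let sgn2 (s : bool) : (-1) ^+ s * (-1) ^+ s = 1 :> R.
Proof. by rewrite -signr_addb addbb. Qed.

Let dotp_eps i j : dotp (eps i) (eps j) = (i == j)%:R.
Proof.
rewrite dotpZl dotpZr dotp_e; have [->|_] := eqVneq i j; last by rewrite !mulr0.
by rewrite mulr1 sgn2.
Qed.

Let dotp_l i (s : bool) : dotp l ((-1) ^+ s *: e i) = (-1) ^+ s * l 0 i.
Proof. by rewrite dotpZr dotp_delta. Qed.

Let dotp_leps i : dotp l (eps i) = mu i.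
Proof.
rewrite dotp_l /mu /sgn; case: ltrP => li; first by rewrite expr1 mulN1r ltr0_norm.
by rewrite mul1r ger0_norm.
Qed.

Let signP i (s : bool) : 0 < (-1) ^+ s * l 0 i -> (-1) ^+ s *: e i = eps i.
Proof.
rewrite /eps /sgn; case: s; rewrite ?expr1 ?expr0 ?mulN1r ?mul1r => li.
  by move: li; rewrite oppr_gt0 => ->.
by rewrite ltNge ltW.
Qed.

Let eps_sign i (s : bool) : (-1) ^+ s *: e i = (-1) ^+ (s (+) sgn i) *: eps i.
Proof. by rewrite scalerA signr_addb -mulrA sgn2 mulr1. Qed.

Let sign_le i (s : bool) : (-1) ^+ s * l 0 i <= mu i.
Proof. by case: s; rewrite ?expr1 ?expr0 ?mulN1r ?mul1r /mu ?ler_norm // -normrN ler_norm. Qed.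

Section TypeD.
Hypothesis regD : forall v, rootD v -> dotp l v != 0.

Let mu_inj : injective mu.
Proof.
move=> i j ij; apply/eqP; apply: contraT => neq_ij.
have := regD (v := eps i - eps j); rewrite dotpBr !dotp_leps ij subrr eqxx.
apply; exists i, j, (sgn i), (~~ sgn j); split=> //.
by rewrite signrN scaleNr.
Qed.

(** In a positive root the term of larger mu is positive on l, since it dominates
    the other one. *)
Lemma rootD_pos v : rootD v /\ 0 < dotp l v <-> posD eps mu [set: 'I_n] v.
Proof.
split.
  have main i j s t : mu j < mu i ->
      0 < dotp l ((-1) ^+ nat_of_bool s *: e i + (-1) ^+ nat_of_bool t *: e j) ->
      posD eps mu [set: 'I_n]
        ((-1) ^+ nat_of_bool s *: e i + (-1) ^+ nat_of_bool t *: e j).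
    move=> ji; rewrite dotpDr !dotp_l => pos.
    have si : 0 < (-1) ^+ s * l 0 i.
      rewrite ltNge; apply/negP => le0.
      have li : (-1) ^+ s * l 0 i = - mu i.
        move: le0; rewrite /mu; case: (s); rewrite ?expr1 ?expr0 ?mulN1r ?mul1r.
          by rewrite oppr_le0 => /ger0_norm ->.
        by move=> /ler0_norm ->; rewrite opprK.
      have := sign_le j t; move: pos ji; rewrite li; lra.
    by exists i, j, (t (+) sgn j); rewrite !inE -eps_sign (signP si).
  move=> [[i [j [s [t [ij ->]]]]] pos].
  case: (ltgtP (mu j) (mu i)) => [ji|ij'|/mu_inj ji]; first exact: main.
    by rewrite addrC in pos *; apply: main.
  by rewrite ji eqxx in ij.
move=> [i [j [s [_ _ ji ->]]]]; split; last first.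
  rewrite dotpDr dotp_leps [dotp l (_ *: eps j)]dotpZr dotp_leps.
  have mj : 0 <= mu j := normr_ge0 _.
  by case: s; rewrite ?expr1 ?expr0 ?mulN1r ?mul1r; lra.
exists i, j, (sgn i), (s (+) sgn j); split.
  by apply: contraTneq ji => ->; rewrite ltxx.
by rewrite (eps_sign j (s (+) sgn j)) addbK.
Qed.

Lemma cascade_rootD :
  exists2 K, cascade (fun v => rootD v /\ 0 < dotp l v) K & size K = (n - odd n)%N.
Proof.
have [K cK sK] := cascadeBD dotp_eps mu_inj false [set: 'I_n].
exists K; last by rewrite sK cardsT card_ord.
apply: cascade_ext cK => v; rewrite rootD_pos; split; last by right.
by case=> [[]|].
Qed.

Hypothesis regS : forall i, l 0 i != 0.

Let mu_gt0 i : 0 < mu i. Proof. by rewrite normr_gt0. Qed.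

Lemma cascade_rootB :
  exists2 K, cascade (fun v => rootB v /\ 0 < dotp l v) K & size K = n.
Proof.
have [K cK sK] := cascadeBD dotp_eps mu_inj true [set: 'I_n].
exists K; last by rewrite sK cardsT card_ord.
apply: cascade_ext cK => v; split.
  case=> [[_ [k _ ->]]|/rootD_pos[vD v0]]; last by split=> //; right.
  by rewrite dotp_leps; split=> //; left; exists k, (sgn k).
move=> [[[i [s ->]]|vD] v0]; last by right; apply/rootD_pos.
by left; split=> //; exists i; rewrite ?inE // signP // -dotp_l.
Qed.

Lemma cascade_rootC :
  exists2 K, cascade (fun v => Defs.rootC v /\ 0 < dotp l v) K & size K = n.
Proof.
have [K cK sK] := cascadeC dotp_eps mu_inj [set: 'I_n].
exists K; last by rewrite sK cardsT card_ord.
apply: cascade_ext cK => v; split.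
  case=> [[k _ ->]|/rootD_pos[vD v0]]; last by split=> //; right.
  rewrite [dotp l (2 *: _)]dotpZr dotp_leps mulr_gt0 ?ltr0n //; split=> //; left.
  by exists k, (sgn k); rewrite scalerA.
move=> [[[i [s ->]]|vD] v0]; last by right; apply/rootD_pos.
left; exists i; rewrite ?inE //; move: v0; rewrite -scalerA [dotp l (2 *: _)]dotpZr.
by rewrite pmulr_rgt0 ?ltr0n // dotp_l => /signP ->.
Qed.

End TypeD.
End ClassicalCascades.

(** * Integral models of the exceptional root systems *)

(** The exceptional root systems are handled by computation on integer vectors,
    the doubles of the roots, which may have half-integral coordinates. *)
Fixpoint dotz (x y : seq int) : int :=
  match x, y with
  | a :: x', b :: y' => a * b + dotz x' y'
  | _, _ => 0
  end.

Fixpoint subz (c : int) (x y : seq int) : seq int :=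
  match x, y with
  | a :: x', b :: y' => (a - c * b) :: subz c x' y'
  | _, _ => [::]
  end.

Definition oppz (x : seq int) : seq int := [seq - a | a <- x].

Definition coefz (z a : seq int) : int := (2 * dotz z a %/ dotz a a)%Z.

Fixpoint cascadez (P K : seq (seq int)) : bool :=
  match K with
  | [::] => nilp P
  | b :: K' =>
    [&& b \in P,
        all (fun z => [|| z == b, dotz z b == 0
                        | (2 * dotz z b == dotz b b) && (subz 1 b z \in P)]) P
      & cascadez [seq z <- P | dotz z b == 0] K']
  end.

Definition positive_part (Rz : seq (seq int)) (rho : seq int) : seq (seq int) :=
  undup [seq z <- Rz | 0 < dotz rho z].

(** The finite verification on which the descent to the reference chamber rests:
    the roots are the positive ones and their opposites, a positive root is
    simple or exceeds another one by a simple root, the reflection in a simple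
    root a has integral coefficients and permutes the positive roots other
    than a, and Kz is a cascade. *)
Definition chamber_ok n (Rz Sz : seq (seq int)) rho Kz : bool :=
  let Pz := positive_part Rz rho in
  [&& all (fun z => size z == n) (rho :: Rz),
      all (fun z => (z \in Pz) || (oppz z \in Pz)) Rz,
      all (fun z => oppz z \in Rz) Pz,
      all (fun z => (z \in Sz) || has (fun a => subz 1 z a \in Pz) Sz) Pz,
      all (fun a => [&& a \in Pz, dotz a a != 0 &
        all (fun z => (z == a) || let c := coefz z a in
          (c * dotz a a == 2 * dotz z a) && (subz c z a \in Pz)) Pz]) Sz
    & cascadez Pz Kz].

Definition pairsz n : seq (nat * nat) :=
  [seq p <- [seq (i, j) | i <- iota 0 n, j <- iota 0 n] | p.1 != p.2].
Definition signz (s : bool) : int := if s then -1 else 1.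
Definition bools := [:: false; true].

Definition pairz n i j s t : seq int :=
  [seq (2 * signz s * (k == i)%:R + 2 * signz t * (k == j)%:R)%R | k <- iota 0 n].
Definition rootsDz n : seq (seq int) :=
  [seq pairz n p.1 p.2 q.1 q.2 | p <- pairsz n,
     q <- [seq (s, t) | s <- bools, t <- bools]].
Definition shortz n : seq (seq int) :=
  [seq [seq 2 * signz s * (k == i)%:R | k <- iota 0 n] | i <- iota 0 n, s <- bools].
Fixpoint signsz n : seq (seq bool) :=
  if n is m.+1 then [seq s :: w | s <- bools, w <- signsz m] else [:: [::]].
Definition halfz (w : seq bool) : seq int := map signz w.

Definition rootsE8z :=
  rootsDz 8 ++ map halfz [seq w <- signsz 8 | ~~ odd (count id w)].
Definition rootsE7z := [seq z <- rootsE8z | z`_6 == - z`_7].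
Definition rootsE6z := [seq z <- rootsE7z | z`_5 == z`_6].
Definition rootsF4z := shortz 4 ++ rootsDz 4 ++ map halfz (signsz 4).
Definition rootsG2z : seq (seq int) :=
  [seq [seq 2 * ((k == p.1)%:R - (k == p.2)%:R) | k <- iota 0 3] | p <- pairsz 3] ++
  [seq [seq 2 * signz s * (3 * (k == i)%:R - 1) | k <- iota 0 3]
     | i <- iota 0 3, s <- bools].

(** The numbering of the simple roots is that of Bourbaki, for which those of E6
    and E7 are the first six and seven of E8, and rhoE8 is the half sum of the
    positive roots. *)
Definition rhoE8 : seq int := [:: 0; 1; 2; 3; 4; 5; 6; 23].
Definition simpleE8 : seq (seq int) :=
 [:: [:: 1; -1; -1; -1; -1; -1; -1; 1]; [:: 2; 2; 0; 0; 0; 0; 0; 0];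
     [:: -2; 2; 0; 0; 0; 0; 0; 0]; [:: 0; -2; 2; 0; 0; 0; 0; 0];
     [:: 0; 0; -2; 2; 0; 0; 0; 0]; [:: 0; 0; 0; -2; 2; 0; 0; 0];
     [:: 0; 0; 0; 0; -2; 2; 0; 0]; [:: 0; 0; 0; 0; 0; -2; 2; 0]].
(** The highest root of E8 is e_7 + e_8. Its orthogonal is E7, with highest
    root e_8 - e_7, so that the other members form a cascade of E7. *)
Definition cascadeE8 : seq (seq int) :=
 [:: [:: 0; 0; 0; 0; 0; 0; 2; 2]; [:: 0; 0; 0; 0; 0; 0; -2; 2];
     [:: 0; 0; 0; 0; 2; 2; 0; 0]; [:: 0; 0; 0; 0; -2; 2; 0; 0];
     [:: 0; 0; 2; 2; 0; 0; 0; 0]; [:: 0; 0; -2; 2; 0; 0; 0; 0];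
     [:: 2; 2; 0; 0; 0; 0; 0; 0]; [:: -2; 2; 0; 0; 0; 0; 0; 0]].
Definition cascadeE6 : seq (seq int) :=
 [:: [:: 1; 1; 1; 1; 1; -1; -1; 1]; [:: -1; -1; -1; -1; 1; -1; -1; 1];
     [:: -2; 0; 0; 2; 0; 0; 0; 0]; [:: 0; -2; 2; 0; 0; 0; 0; 0]].
Definition simpleF4 : seq (seq int) :=
 [:: [:: 0; 2; -2; 0]; [:: 0; 0; 2; -2]; [:: 0; 0; 0; 2]; [:: 1; -1; -1; -1]].
Definition cascadeF4 : seq (seq int) :=
 [:: [:: 2; 2; 0; 0]; [:: 2; -2; 0; 0]; [:: 0; 0; 2; 2]; [:: 0; 0; 2; -2]].

Lemma chamber_G2 : chamber_ok 3 rootsG2z [:: [:: 2; -2; 0]; [:: -4; 2; 2]]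
  [:: -1; -2; 3] [:: [:: -2; -2; 4]; [:: 2; -2; 0]].
Proof. by vm_compute. Qed.
Lemma chamber_F4 : chamber_ok 4 rootsF4z simpleF4 [:: 11; 5; 3; 1] cascadeF4.
Proof. by vm_compute. Qed.
Lemma chamber_E6 : chamber_ok 8 rootsE6z (take 6 simpleE8) rhoE8 cascadeE6.
Proof. by vm_compute. Qed.
Lemma chamber_E7 : chamber_ok 8 rootsE7z (take 7 simpleE8) rhoE8 (behead cascadeE8).
Proof. by vm_compute. Qed.
Lemma chamber_E8 : chamber_ok 8 rootsE8z simpleE8 rhoE8 cascadeE8.
Proof. by vm_compute. Qed.

(** * Transport of cascades along the Weyl group *)

Section WeylDescent.
Variables (R : realFieldType) (n : nat).
Implicit Types u v w a b l : 'rV[R]_n.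

Definition refl b v := v - (2 * dotp v b / dotp b b) *: b.

Lemma refl_lin b c u v : refl b (c *: u + v) = c *: refl b u + refl b v.
Proof.
rewrite /refl dotpDl dotpZl.
have -> : 2 * (c * dotp u b + dotp v b) / dotp b b =
    c * (2 * dotp u b / dotp b b) + 2 * dotp v b / dotp b b by ring.
by rewrite scalerDl -scalerA scalerBr opprD addrACA.
Qed.

Lemma reflB b u v : refl b (u - v) = refl b u - refl b v.
Proof.
by have := refl_lin b (-1) v u; rewrite !scaleN1r addrC => ->; rewrite addrC.
Qed.

Lemma reflN b v : refl b (- v) = - refl b v.
Proof.
have := reflB b v v; rewrite !subrr => r0.
by rewrite -[- v]add0r reflB r0 add0r.
Qed.

Section Root.
Variable b : 'rV[R]_n.
Hypothesis b0 : b != 0.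

Let bb : dotp b b != 0. Proof. by rewrite gt_eqF ?dotp_gt0. Qed.

Lemma refl_self : refl b b = - b.
Proof.
by rewrite /refl mulfK // scaler_nat mulr2n opprD addrA subrr add0r.
Qed.

Lemma dotp_refl u v : dotp (refl b u) (refl b v) = dotp u v.
Proof.
rewrite dotpBl !dotpBr !dotpZl !dotpZr [dotp b v]dotpC.
by field.
Qed.

Lemma dotp_reflC u v : dotp (refl b u) v = dotp u (refl b v).
Proof. by rewrite dotpBl dotpBr dotpZl dotpZr [dotp b v]dotpC; ring. Qed.

Lemma reflK : involutive (refl b).
Proof.
move=> v; rewrite {1}/refl dotp_reflC refl_self dotpNr mulrN mulNr scaleNr.
by rewrite opprK subrK.
Qed.

End Root.

(** Reflections are linear isometries, and the notion of a cascade only uses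
    sums and scalar products. *)
Lemma cascade_refl b (P Q : 'rV[R]_n -> Prop) K : b != 0 ->
  (forall v, Q v <-> P (refl b v)) -> cascade P K -> cascade Q (map (refl b) K).
Proof.
move=> b0; elim: K P Q => [|c K IH] P Q QP /=.
  by move=> P0 v /QP; apply: P0.
have dotb v : dotp v (refl b c) = dotp (refl b v) c by rewrite dotp_reflC.
move=> [Pc Pv casc]; split.
- by apply/QP; rewrite reflK.
- move=> v /QP /Pv[vE|v0|[v1 Pcv]].
  + by apply: Or31; rewrite -vE reflK.
  + by apply: Or32; rewrite dotb.
  apply: Or33; rewrite dotp_refl // dotb; split=> //; apply/QP.
  by rewrite reflB reflK.
by apply: IH casc => v; rewrite dotb QP.
Qed.

Lemma exists_argmin (T : eqType) (f : T -> R) (s : seq T) : s != [::] ->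
  exists2 x, x \in s & {in s, forall y, f x <= f y}.
Proof.
elim: s => // x s IH _; have [->|/IH[y ys ymin]] := eqVneq s [::].
  by exists x; rewrite ?mem_head // => z; rewrite inE => /eqP ->.
have [xy|yx] := lerP (f x) (f y).
  exists x; rewrite ?mem_head // => z; rewrite inE => /predU1P[->//|/ymin].
  exact: le_trans.
exists y; rewrite ?inE ?ys ?orbT // => z; rewrite inE => /predU1P[->|/ymin//].
exact: ltW.
Qed.

Variables (rho : 'rV[R]_n) (Pv Sv : seq 'rV[R]_n) (Kv : seq 'rV[R]_n).
Hypothesis Pv_uniq : uniq Pv.
Hypothesis Pv_pos : {in Pv, forall v, 0 < dotp rho v}.
Hypothesis Sv_Pv : {subset Sv <= Pv}.
Hypothesis Pv_decomp : {in Pv, forall v,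
  v \in Sv \/ exists2 a, a \in Sv & v - a \in Pv}.
Hypothesis Pv_refl : {in Sv & Pv, forall a v, v != a -> refl a v \in Pv}.
Hypothesis Pv_cascade : cascade (fun v => v \in Pv) Kv.

Let rt v := (v \in Pv) || (- v \in Pv).

(** Induction on the number of reference positive roots that are negative
    on l. If there is one, then one of least value on rho is simple, since in a
    sum of two positive roots one term is negative too and has a smaller value
    on rho. Reflecting l in a simple root a with l(a) < 0 lowers this number,
    because the reflection permutes the positive roots other than a. If there is
    none, the two chambers coincide. *)
Lemma chamber_cascade l : (forall v, rt v -> dotp l v != 0) ->
  exists2 K, cascade (fun v => rt v /\ 0 < dotp l v) K & size K = size Kv.
Proof.
have Pv_neq0 v : v \in Pv -> v != 0.
  by move=> /Pv_pos; apply: contraTneq => ->; rewrite dotp0r ltxx.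
pose neg l := [seq v <- Pv | dotp l v < 0].
have [m] := ubnP (size (neg l)); elim: m l => // m IH l; rewrite ltnS => le_m reg.
have [neg0|] := eqVneq (neg l) [::].
  have pos v : v \in Pv -> 0 < dotp l v.
    move=> vP; rewrite lt_def reg /rt ?vP //= leNgt; apply/negP => lv.
    by have : v \in neg l; [rewrite mem_filter lv | rewrite neg0].
  exists Kv => //; apply: cascade_ext Pv_cascade => v; rewrite /rt.
  split=> [vP|[/orP[//|nvP] v0]]; first by rewrite vP pos.
  by have := pos _ nvP; rewrite dotpNr oppr_gt0 ltNge ltW.
move=> /(exists_argmin (dotp rho))[v]; rewrite mem_filter => /andP[lv vP] vmin.
have [a aS la] : exists2 a, a \in Sv & dotp l a < 0.
  have [vS|[a aS vaP]] := Pv_decomp vP; first by exists v.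
  exists a => //; rewrite ltNge; apply/negP => la.
  have /vmin : v - a \in neg l.
    by rewrite mem_filter vaP andbT dotpBr subr_lt0 (lt_le_trans lv).
  rewrite dotpBr lerDl oppr_ge0 leNgt.
  by rewrite Pv_pos ?Sv_Pv.
have aP := Sv_Pv aS; have a0 := Pv_neq0 a aP.
have lE w : dotp (refl a l) w = dotp l (refl a w) by rewrite dotp_reflC.
have rtE w : rt (refl a w) -> rt w.
  have main u : u \in Pv -> rt (refl a u).
    move=> uP; have [->|ua] := eqVneq u a; last by rewrite /rt Pv_refl.
    by rewrite refl_self // /rt opprK aP orbT.
  case/orP => /main; first by rewrite reflK.
  by rewrite reflN reflK // /rt opprK orbC.
have rtE' w : rt w -> rt (refl a w) by move=> rw; apply: rtE; rewrite reflK.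
have [|w /rtE' /reg|K cK sK] := IH (refl a l).
(* a and the reflected roots are distinct negative roots for l. *)
- apply: leq_trans le_m; pose s := a :: map (refl a) (neg (refl a l)).
  have negP u : u \in neg (refl a l) -> [/\ u \in Pv, u != a & dotp l (refl a u) < 0].
    rewrite mem_filter lE => /andP[lu uP]; split=> //.
    by apply: contraTneq lu => ->; rewrite refl_self // dotpNr oppr_lt0 -leNgt ltW.
  have <- : size s = (size (neg (refl a l))).+1 by rewrite /= size_map.
  apply: uniq_leq_size.
    rewrite /= map_inj_uniq ?filter_uniq // ?andbT; last exact: inv_inj (reflK a0).
    apply/mapP => -[u /negP[uP _ lu] aE]; have := Pv_pos aP.
    have -> : a = - u by rewrite -[u](reflK a0) -aE refl_self ?opprK.
    by rewrite dotpNr oppr_gt0 ltNge ltW ?Pv_pos.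
  move=> u; rewrite inE => /predU1P[->|/mapP[w /negP[wP wa lw] ->]].
    by rewrite mem_filter la aP.
  by rewrite mem_filter lw Pv_refl.
- by rewrite lE.
exists (map (refl a) K); last by rewrite size_map.
apply: cascade_refl cK => // w; rewrite lE reflK //.
by split=> -[rw lw]; split=> //; [apply: rtE' | apply: rtE].
Qed.

End WeylDescent.

Section IntegralVectors.
Variables (R : realFieldType) (n : nat).
Implicit Types x y z : seq int.

(** The division by 2 undoes the doubling of the coordinates. *)
Definition vec z : 'rV[R]_n := \row_i ((z`_i)%:~R / 2).

Lemma nth_subz c x y i : size x = size y -> (subz c x y)`_i = x`_i - c * y`_i.
Proof.
elim: x y i => [|a x IH] [|b y] [|i] //=; rewrite ?mulr0 ?subr0 // => -[] /IH.
exact.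
Qed.

Lemma nth_oppz x i : (oppz x)`_i = - x`_i.
Proof.
have [ix|ix] := ltnP i (size x); first by rewrite (nth_map 0).
by rewrite !nth_default ?size_map // oppr0.
Qed.

Lemma vec_subz c x y : size x = n -> size y = n ->
  vec (subz c x y) = vec x - c%:~R *: vec y.
Proof.
move=> sx sy; apply/rowP => i; rewrite !mxE nth_subz ?sx ?sy //.
by rewrite rmorphB rmorphM mulrBl mulrA.
Qed.

Lemma vec_oppz x : vec (oppz x) = - vec x.
Proof. by apply/rowP => i; rewrite !mxE nth_oppz rmorphN mulNr. Qed.

Lemma vec_inj x y : size x = n -> size y = n -> vec x = vec y -> x = y.
Proof.
move=> sx sy /rowP xy; apply: (@eq_from_nth _ 0); first by rewrite sx.
rewrite sx => i ltin; have := xy (Ordinal ltin); rewrite !mxE /=.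
by move=> /(mulIf _)/intr_inj -> //; rewrite invr_eq0 pnatr_eq0.
Qed.

Lemma dotzE m x y : size x = m -> size y = m ->
  dotz x y = \sum_(i < m) x`_i * y`_i.
Proof.
elim: m x y => [|m IH] [|a x] [|b y] //= => [_ _|[sx] [sy]].
  by rewrite big_ord0.
by rewrite big_ord_recl IH.
Qed.

Lemma dotp_vec x y : size x = n -> size y = n ->
  dotp (vec x) (vec y) = (dotz x y)%:~R / 4.
Proof.
move=> sx sy; rewrite (dotzE sx sy) rmorph_sum mulr_suml.
apply: eq_bigr => i _; rewrite !mxE rmorphM mulrACA.
by congr (_ * _); rewrite -invfM -natrM.
Qed.

Lemma cascadez_sound (P K : seq (seq int)) :
  {in P, forall z, size z = n} -> cascadez P K ->
  cascade (fun v => v \in map vec P) (map vec K).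
Proof.
elim: K P => [|b K IH] P sP /=.
  by move=> /nilP -> v; rewrite in_nil.
move=> /and3P[bP /allP Pb casc]; have sb := sP b bP.
have quarter0 (k : int) : (k%:~R / 4 == 0 :> R) = (k == 0).
  by rewrite mulf_eq0 invr_eq0 pnatr_eq0 orbF intr_eq0.
split; first exact: map_f.
  move=> _ /mapP[z zP ->]; have sz := sP z zP.
  have /or3P[/eqP ->|/eqP z0|/andP[/eqP z1 bzP]] := Pb z zP.
  - exact: Or31.
  - by apply/Or32/eqP; rewrite dotp_vec // quarter0 z0.
  apply: Or33; rewrite !dotp_vec // -z1 rmorphM mulrA; split=> //.
  by rewrite -[vec z]scale1r -(vec_subz 1) // map_f.
apply: cascade_ext (IH [seq z <- P | dotz z b == 0] _ casc) => [v|z].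
  split=> [/mapP[z]|[/mapP[z zP ->] /eqP]].
    rewrite mem_filter => /andP[/eqP z0 zP] ->; rewrite map_f //; split=> //.
    by apply/eqP; rewrite dotp_vec ?sP // quarter0 z0.
  by rewrite dotp_vec ?sP // quarter0 => z0; rewrite map_f // mem_filter z0.
by rewrite mem_filter => /andP[_ /sP].
Qed.

Lemma chamber_ok_cascade Rz Sz rho Kz (rt : 'rV[R]_n -> Prop) (l : 'rV[R]_n) :
  chamber_ok n Rz Sz rho Kz ->
  (forall v, rt v <-> exists2 z, z \in Rz & v = vec z) ->
  (forall v, rt v -> dotp l v != 0) ->
  exists2 K, cascade (fun v => rt v /\ 0 < dotp l v) K & size K = size Kz.
Proof.
rewrite /chamber_ok; set Pz := positive_part Rz rho.
case/and5P => /andP[/eqP srho /allP sR] /allP RP /allP PR /allP Pdec.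
case/andP => /allP Sz_ok Kz_ok rtE reg.
have PzP z : z \in Pz -> z \in Rz /\ 0 < dotz rho z.
  by rewrite mem_undup mem_filter => /andP[].
have sP z : z \in Pz -> size z = n by move=> /PzP[/sR/eqP].
have SP : {subset Sz <= Pz} by move=> a /Sz_ok/and3P[].
have vecP v : (v \in map vec Pz) || (- v \in map vec Pz) <-> rt v.
  rewrite rtE; split=> [/orP[]/mapP[z zP]|[z zR ->]].
  - by move=> ->; exists z => //; have [] := PzP z zP.
  - by move=> vE; exists (oppz z); rewrite ?PR // vec_oppz -vE opprK.
  have /orP[zP|zP] := RP z zR; first by rewrite map_f.
  by rewrite -vec_oppz (map_f vec zP) orbT.
have [|||||||K cK sK] := @chamber_cascade R n (vec rho) (map vec Pz) (map vec Sz)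
    (map vec Kz) _ _ _ _ _ _ l.
- rewrite map_inj_in_uniq ?undup_uniq // => x y /sP sx /sP sy.
  exact: vec_inj.
- move=> _ /mapP[z zP ->]; have [_ z0] := PzP z zP.
  by rewrite dotp_vec ?(sP z zP) // divr_gt0 ?ltr0z ?ltr0n.
- by move=> _ /mapP[z /SP zP ->]; apply: map_f.
- move=> _ /mapP[z zP ->]; have /orP[zS|/hasP[a aS zaP]] := Pdec z zP.
    by left; apply: map_f.
  right; exists (vec a); first exact: map_f.
  have aP := SP a aS.
  by rewrite -[vec a]scale1r -(vec_subz 1) ?(sP z) ?(sP a) // map_f.
- move=> _ _ /mapP[a aS ->] /mapP[z zP ->]; have aP := SP a aS.
  have /and3P[_ aa0 /allP/(_ z zP)] := Sz_ok a aS.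
  case/predU1P => [->|/andP[/eqP cE zaP] _]; first by rewrite eqxx.
  have aaR : (dotz a a)%:~R != 0 :> R by rewrite intr_eq0.
  rewrite /refl !dotp_vec ?sP //.
  have -> : 2 * ((dotz z a)%:~R / 4) / ((dotz a a)%:~R / 4) = (coefz z a)%:~R :> R.
    have := congr1 (fun k : int => k%:~R : R) cE; rewrite /= !rmorphM /= => cER.
    by apply: (mulIf aaR); rewrite cER; field.
  by rewrite -vec_subz ?sP // map_f.
- by apply: cascadez_sound Kz_ok => z /sP.
- by move=> v /vecP/reg.
exists K; last by rewrite sK size_map.
by apply: cascade_ext cK => v; rewrite vecP.
Qed.

End IntegralVectors.

(** * The exceptional root systems have integral models *)

Section StandardRootsIntegral.
Variables (R : realFieldType) (n : nat).
Local Notation vecn := (@vec R n).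
Local Notation e i := (delta_mx 0 i : 'rV[R]_n).

Lemma vec_iota (F : nat -> int) (i : 'I_n) :
  vecn [seq F k | k <- iota 0 n] 0 i = (F i)%:~R / 2.
Proof. by rewrite mxE (nth_map 0%N) ?size_iota // nth_iota. Qed.

Lemma signzE (s : bool) : (signz s)%:~R = (-1) ^+ s :> R.
Proof. by case: s. Qed.

Lemma vec_pairz (i j : 'I_n) s t :
  vecn (pairz n i j s t) = (-1) ^+ nat_of_bool s *: e i + (-1) ^+ nat_of_bool t *: e j.
Proof.
apply/rowP => k; rewrite vec_iota !mxE /= rmorphD !rmorphM /= !signzE !natz.
by rewrite -!pmulrn -!(inj_eq val_inj) /=; field.
Qed.

Lemma mem_bools (s : bool) : s \in bools. Proof. by case: s. Qed.

Lemma pairszP i j : ((i, j) \in pairsz n) = [&& i != j, (i < n)%N & (j < n)%N].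
Proof.
rewrite mem_filter /=; congr (_ && _); apply/allpairsP/andP.
  by move=> [[i' j'] /= [+ + [-> ->]]]; rewrite !mem_iota.
by move=> [ilt jlt]; exists (i, j); rewrite !mem_iota.
Qed.

Lemma rootD_integral (v : 'rV[R]_n) :
  rootD v <-> exists2 z, z \in rootsDz n & v = vecn z.
Proof.
split=> [[i [j [s [t [ij ->]]]]]|[z /allpairsP[[[i j] [s t]] /= [pij _ ->]] ->]].
  exists (pairz n i j s t); last by rewrite vec_pairz.
  apply: (allpairs_f (fun p q => pairz n p.1 p.2 q.1 q.2)
           (x := (i : nat, j : nat)) (y := (s, t))).
    by rewrite pairszP !ltn_ord ij.
  by apply: allpairs_f; apply: mem_bools.
move: pij; rewrite pairszP => /and3P[ij ilt jlt].
exists (Ordinal ilt), (Ordinal jlt), s, t; split=> //.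
exact: (vec_pairz (Ordinal ilt) (Ordinal jlt)).
Qed.

Lemma root_short_integral (v : 'rV[R]_n) :
  root_short v <-> exists2 z, z \in shortz n & v = vecn z.
Proof.
have vE (i : 'I_n) s : vecn [seq 2 * signz s * (k == i :> nat)%:R | k <- iota 0 n]
    = (-1) ^+ nat_of_bool s *: e i.
  apply/rowP => k; rewrite vec_iota !mxE /= !rmorphM /= signzE natz.
  by rewrite -pmulrn -(inj_eq val_inj) /=; field.
split=> [[i [s ->]]|[z /allpairsP[[i s] /= [+ _ ->]] ->]].
  exists [seq 2 * signz s * (k == i :> nat)%:R | k <- iota 0 n]; last by rewrite vE.
  apply: (allpairs_f (fun i s => [seq 2 * signz s * (k == i :> nat)%:R | k <- iota 0 n])).
    by rewrite mem_iota /= ltn_ord.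
  exact: mem_bools.
rewrite mem_iota => ilt; exists (Ordinal ilt), s.
exact: (vE (Ordinal ilt)).
Qed.

Lemma mem_signsz m w : (w \in signsz m) = (size w == m).
Proof.
elim: m w => [|m IH] w; first by rewrite inE size_eq0.
apply/allpairsP/idP => [[[s w'] [_ /= + ->]]|]; first by rewrite IH.
by case: w => // s w sw; exists (s, w); rewrite mem_bools IH.
Qed.

Lemma half_spin_integral (s : 'I_n -> bool) (w : seq bool) :
  size w = n -> (forall i, s i = nth false w i) ->
  half_spin R s = vecn (halfz w).
Proof.
move=> sw swE; apply/rowP => k; rewrite !mxE summxE (bigD1 k) //= !mxE !eqxx.
rewrite mulr1 big1 ?addr0 => [|i ik]; last first.
  by rewrite !mxE eq_sym (negPf ik) mulr0.
by rewrite (nth_map false) ?sw // swE signzE mulrC.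
Qed.

Lemma count_id_sum (w : seq bool) :
  (count id w = \sum_(i < size w) nth false w i)%N.
Proof.
by elim: w => [|s w IH]; rewrite /= ?big_ord0 // big_ord_recl /= -IH.
Qed.

Lemma half_spin_all (P : nat -> bool) (v : 'rV[R]_n) :
  (exists s : 'I_n -> bool, P (\sum_i s i)%N /\ v = half_spin R s) <->
  exists2 z, z \in [seq halfz w | w <- signsz n & P (count id w)] & v = vecn z.
Proof.
split=> [[s [Ps ->]]|[z /mapP[w + ->] ->]].
  pose w := [seq s i | i <- enum 'I_n].
  have sw : size w = n by rewrite size_map size_enum_ord.
  have sE i : s i = nth false w i.
    by rewrite (nth_map i) ?size_enum_ord // nth_ord_enum.
  exists (halfz w); last exact: half_spin_integral.
  apply: map_f; rewrite mem_filter mem_signsz sw eqxx andbT count_id_sum.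
  by rewrite sw; move: Ps; congr (P _); apply: eq_bigr => i _; rewrite sE.
rewrite mem_filter mem_signsz => /andP[Pw /eqP sw].
exists (fun i => nth false w i); split.
  by move: Pw; rewrite count_id_sum sw.
by apply/esym/half_spin_integral.
Qed.

End StandardRootsIntegral.

Section Exceptional.
Variable R : realFieldType.

Lemma mem_cat_ex (T : eqType) (U : Type) (f : T -> U) (s1 s2 : seq T) v :
  (exists2 z, z \in s1 ++ s2 & v = f z) <->
  (exists2 z, z \in s1 & v = f z) \/ (exists2 z, z \in s2 & v = f z).
Proof.
split=> [[z + ->]|[[z zs ->]|[z zs ->]]].
- by rewrite mem_cat => /orP[]; [left|right]; exists z.
- by exists z; rewrite // mem_cat zs.
- by exists z; rewrite // mem_cat zs orbT.
Qed.

Lemma rootE8_integral (v : 'rV[R]_8) :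
  rootE8 v <-> exists2 z, z \in rootsE8z & v = vec R 8 z.
Proof.
rewrite mem_cat_ex -rootD_integral.
by rewrite -(half_spin_all (fun k => ~~ odd k)).
Qed.

Lemma vec_inord z k : (k < 8)%N -> vec R 8 z 0 (inord k) = (z`_k)%:~R / 2.
Proof. by move=> k8; rewrite mxE inordK. Qed.

Let half_inj : injective (fun k : int => k%:~R / 2 : R).
Proof. by move=> k m /(mulIf _)/intr_inj -> //; rewrite invr_eq0 pnatr_eq0. Qed.

Lemma rootE7_integral (v : 'rV[R]_8) :
  rootE7 v <-> exists2 z, z \in rootsE7z & v = vec R 8 z.
Proof.
have E z : (vec R 8 z 0 (inord 6) == - vec R 8 z 0 (inord 7)) = (z`_6 == - z`_7).
  by rewrite !vec_inord // -mulNr -rmorphN (inj_eq half_inj).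
rewrite /rootE7 rootE8_integral.
split=> [[[z zR ->] /eqP]|[z]].
  by rewrite E => zE; exists z; [rewrite mem_filter zE; exact: zR|].
rewrite mem_filter -E => /andP[/eqP zE zR] ->; split; last exact: zE.
by exists z; [exact: zR|].
Qed.

Lemma rootE6_integral (v : 'rV[R]_8) :
  rootE6 v <-> exists2 z, z \in rootsE6z & v = vec R 8 z.
Proof.
have E z : (vec R 8 z 0 (inord 5) == vec R 8 z 0 (inord 6)) = (z`_5 == z`_6).
  by rewrite !vec_inord // (inj_eq half_inj).
rewrite /rootE6 rootE7_integral.
split=> [[[z zR ->] /eqP]|[z]].
  by rewrite E => zE; exists z; [rewrite mem_filter zE; exact: zR|].
rewrite mem_filter -E => /andP[/eqP zE zR] ->; split; last exact: zE.
by exists z; [exact: zR|].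
Qed.

Lemma rootF4_integral (v : 'rV[R]_4) :
  rootF4 v <-> exists2 z, z \in rootsF4z & v = vec R 4 z.
Proof.
have cat3 (s1 s2 s3 : seq (seq int)) (P1 P2 P3 : Prop) :
    (P1 <-> exists2 z, z \in s1 & v = vec R 4 z) ->
    (P2 <-> exists2 z, z \in s2 & v = vec R 4 z) ->
    (P3 <-> exists2 z, z \in s3 & v = vec R 4 z) ->
    ((P1 \/ P2) \/ P3) <-> exists2 z, z \in s1 ++ s2 ++ s3 & v = vec R 4 z.
  move=> e1 e2 e3; have c1 := mem_cat_ex (vec R 4) s1 (s2 ++ s3) v.
  have c2 := mem_cat_ex (vec R 4) s2 s3 v.
  by apply: iff_sym; apply: (iff_trans c1); tauto.
apply: cat3; [exact: root_short_integral | exact: rootD_integral | ].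
have := half_spin_all (fun=> true) v; rewrite filter_predT => <-.
by split=> [[s ->]|[s [_ ->]]]; exists s.
Qed.

Lemma rootG2_integral (v : 'rV[R]_3) :
  rootG2 v <-> exists2 z, z \in rootsG2z & v = vec R 3 z.
Proof.
have longE (i j k : 'I_3) (s : bool) : uniq [:: i; j; k] ->
    vec R 3 [seq 2 * signz s * (3 * (m == i :> nat)%:R - 1) | m <- iota 0 3] =
    (-1) ^+ s *: (2 *: delta_mx 0 i - delta_mx 0 j - delta_mx 0 k).
  move=> u; apply/rowP => m; rewrite vec_iota !mxE rmorphM rmorphB !rmorphM /=.
  have -> : 1%:~R = (m == i)%:R + (m == j)%:R + (m == k)%:R :> R.
    by case: i j k m u => [[|[|[|i]]] ?] [[|[|[|j]]] ?] [[|[|[|k]]] ?] [[|[|[|m]]] ?] //= _;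
      rewrite ?addr0 ?add0r.
  by rewrite signzE natz -pmulrn -(inj_eq val_inj m i) /=; field.
rewrite /rootsG2z mem_cat_ex; split=> -[].
- move=> [i [j [ij ->]]]; left.
  exists [seq 2 * ((k == i :> nat)%:R - (k == j :> nat)%:R) | k <- iota 0 3].
    apply: (map_f (fun p => [seq 2 * ((k == p.1)%:R - (k == p.2)%:R) | k <- iota 0 3])
       (x := (i : nat, j : nat))).
    by rewrite pairszP !ltn_ord ij.
  apply/rowP => k; rewrite vec_iota !mxE rmorphM rmorphB /= !natz -!pmulrn.
  by rewrite -!(inj_eq val_inj) /=; field.
- move=> [i [j [k [s [u ->]]]]]; right; rewrite -(longE i j k s u).
  exists [seq 2 * signz s * (3 * (m == i :> nat)%:R - 1) | m <- iota 0 3] => //.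
  apply: (allpairs_f (fun i s => [seq 2 * signz s * (3 * (m == i :> nat)%:R - 1) | m <- iota 0 3])).
    by rewrite mem_iota /= ltn_ord.
  exact: mem_bools.
- move=> [z /mapP[[i j]]]; rewrite pairszP => /and3P[ij ilt jlt] -> ->; left.
  exists (Ordinal ilt), (Ordinal jlt); split=> //.
  apply/rowP => k; rewrite vec_iota !mxE rmorphM rmorphB /= !natz -!pmulrn.
  by rewrite -!(inj_eq val_inj) /=; field.
move=> [z /allpairsP[[i s] [iI _ ->]] ->]; right.
have ilt : (i < 3)%N by move: iI; rewrite mem_iota.
pose o k : 'I_3 := inord ((i + k) %% 3).
have u : uniq [:: Ordinal ilt; o 1%N; o 2%N].
  rewrite /o; case: i ilt {iI o} => [|[|[|//]]] ilt;
    by rewrite /= !inE -!(inj_eq val_inj) /= !inordK.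
exists (Ordinal ilt), (o 1%N), (o 2%N), s; split=> //.
by rewrite -(longE _ _ _ s u).
Qed.

End Exceptional.

(** * The index for each type *)

(** In each type the length of the cascade is known, and the rank is squeezed
    between two bounds: the linear relations satisfied by the roots, and the
    coordinate vectors that they span. When the cascade is as long as the
    dimension of the ambient space allows, the index is 0. *)
Section BorelIndex.
Variables (R : realFieldType) (g : vectType R) (br : g -> g -> g).
Variables (h : {vspace g}) (Delta Delta_plus : seq (dual h)).
Hypotheses (br_lie : lie_bracket br) (g_simple : lie_simple br).
Hypotheses (h_cartan : cartan_subalgebra br h).
Hypotheses (Delta_roots : root_system br Delta).
Hypotheses (g_split : split_wrt br Delta).
Hypothesis plus_pos : positive_system Delta Delta_plus.

Let ib := lie_index (@sub_bracket R g br (borel br Delta_plus)).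
Local Notation e i := (delta_mx 0 i : 'rV[R]_(_)).

Section RootCoordinates.
Variables (n : nat) (phi : 'Hom(dual h, 'rV[R]_n)) (rt : 'rV[R]_n -> Prop).
Hypotheses (phi_inj : lker phi = 0%VS)
  (rtE : forall v, rt v <-> exists2 a, a \in Delta & v = phi a).

Lemma rank_index m :
  (forall l, (forall v, rt v -> dotp l v != 0) ->
     exists2 K, cascade (fun v => rt v /\ 0 < dotp l v) K & size K = m) ->
  \dim h = (ib + m)%N.
Proof.
exact: (borel_index_cascade br_lie g_simple h_cartan Delta_roots g_split phi_inj
          plus_pos rtE).
Qed.

Lemma rank_le_roots (S : seq 'rV[R]_n) : free S ->
  (forall l v, l \in S -> rt v -> dotp l v = 0) -> (\dim h + size S <= n)%N.
Proof.
move=> fS S0; apply: (rank_le br_lie g_simple h_cartan Delta_roots g_split phi_inj fS) => //.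
by move=> l lS a aD; apply: S0 => //; apply/rtE; exists a.
Qed.

Lemma rank_ge_roots (S : seq 'rV[R]_n) :
  (forall W : {vspace 'rV[R]_n}, (forall v, rt v -> v \in W) ->
     {subset S <= W} -> forall i, e i \in W) -> (n <= \dim h + size S)%N.
Proof.
move=> full; apply: (rank_ge phi_inj) => i; apply: full.
  move=> v /rtE[a _ ->]; apply: (subvP (addvSl _ _)).
  exact: memv_img (memvf _).
by move=> v vS; apply: (subvP (addvSr _ _)); apply: memv_span.
Qed.

Lemma rank_le_ambient : (\dim h <= n)%N.
Proof.
by rewrite -[X in (X <= _)%N]addn0; apply: (@rank_le_roots [::]); rewrite ?nil_free.
Qed.

End RootCoordinates.

Lemma index_A r : of_type Delta (typeA r) -> ib = (r %/ 2)%N.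
Proof.
move=> [phi [inj rtE]].
have rk := rank_index inj rtE (@cascade_rootA R r.+1).
have le : (\dim h + 1 <= r.+1)%N.
  apply: (rank_le_roots inj rtE (S := [:: const_mx 1])).
    rewrite seq1_free; apply/eqP => /rowP/(_ ord0)/eqP.
    by rewrite !mxE oner_eq0.
  move=> _ _ /[1!inE] /eqP -> [i [j [_ ->]]].
  by rewrite dotpBr !dotp_delta !mxE subrr.
have ge : (r.+1 <= \dim h + 1)%N.
  apply: (rank_ge_roots inj rtE (S := [:: e ord0])) => W WP WS i.
  have W0 : e ord0 \in W by apply: WS; rewrite inE.
  have [->//|i0] := eqVneq i ord0.
  rewrite -[e i](subrK (e ord0)); apply: memvD => //; apply: WP.
  by exists i, ord0.
lia.
Qed.

Lemma index_B r : of_type Delta (typeB r) -> ib = 0%N.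
Proof.
move=> [phi [inj rtE]]; have le : (\dim h <= r)%N := rank_le_ambient inj rtE.
move: le; rewrite (@rank_index r phi (@rootB R r) inj rtE r); first by move=> ?; lia.
move=> l reg; apply: cascade_rootB => [v vD|i]; first by apply: reg; right.
rewrite -(dotp_delta l i); apply: reg; left; exists i, false.
by rewrite scale1r.
Qed.

Lemma index_C r : of_type Delta (typeC r) -> ib = 0%N.
Proof.
move=> [phi [inj rtE]]; have le : (\dim h <= r)%N := rank_le_ambient inj rtE.
move: le; rewrite (@rank_index r phi (@Defs.rootC R r) inj rtE r); first by move=> ?; lia.
move=> l reg; apply: cascade_rootC => [v vD|i]; first by apply: reg; right.
have : dotp l (2 *: e i) != 0.
  by apply: reg; left; exists i, false; rewrite /= mulr1.
by rewrite dotpZr dotp_delta mulf_eq0 negb_or => /andP[].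
Qed.

Lemma rank_D n (phi : 'Hom(dual h, 'rV[R]_n)) : lker phi = 0%VS ->
  (forall v, rootD v <-> exists2 a, a \in Delta & v = phi a) ->
  \dim h = (ib + (n - odd n))%N.
Proof.
move=> inj rtE; apply: (rank_index inj rtE) => l reg.
exact: cascade_rootD.
Qed.

Lemma mem_e_rootD n (W : {vspace 'rV[R]_n}) i j :
  e i + e j \in W -> e i - e j \in W -> e i \in W.
Proof.
move=> Wp Wm; have -> : e i = 2^-1 *: ((e i + e j) + (e i - e j)).
  rewrite addrCA addrK -[X in X + _]addr0 ?addr0.
  by rewrite -mulr2n -scaler_nat scalerA mulVf ?pnatr_eq0 // scale1r.
by rewrite memvZ // memvD.
Qed.

Lemma Delta_neq_nil : Delta != [::].
Proof.
apply/eqP => D0; apply: (cartan_proper br_lie g_simple h_cartan).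
by apply: (split_full Delta_roots g_split) => //; rewrite D0.
Qed.

Lemma index_D_even r : of_type Delta (typeD (2 * r)) -> ib = 0%N.
Proof.
move=> [phi [inj rtE]]; have le : (\dim h <= 2 * r)%N := rank_le_ambient inj rtE.
have rk : \dim h = (ib + (2 * r - odd (2 * r)))%N := rank_D inj rtE; lia.
Qed.

(** For r = 0 there are no roots and h is the whole of g, which is
    impossible. *)
Lemma index_D_odd r : of_type Delta (typeD (2 * r + 1)) -> ib = 1%N.
Proof.
move=> [phi [inj rtE]]; have le : (\dim h <= 2 * r + 1)%N := rank_le_ambient inj rtE.
have rk : \dim h = (ib + (2 * r + 1 - odd (2 * r + 1)))%N := rank_D inj rtE.
have [r0|r_gt0] := posnP r.
  case: Delta phi rtE Delta_neq_nil {inj rk} => // a D phi rtE _.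
  have /rtE[i [j [s [t [/eqP[]]]]]] : exists2 b, b \in a :: D & phi a = phi b.
    by exists a; rewrite ?mem_head.
  by apply: val_inj; case: i j => [i ilt] [j jlt] /=; lia.
have ge : (2 * r + 1 <= \dim h + 0)%N.
  apply: (rank_ge_roots inj rtE (S := [::])) => W WP _ i.
  have [j ij] : exists j : 'I_(2 * r + 1), i != j.
    have [i0|i0] := eqVneq (i : nat) 0%N.
      have lt1 : (1 < 2 * r + 1)%N by lia.
      by exists (Ordinal lt1); rewrite -(inj_eq val_inj) /= i0.
    have lt0 : (0 < 2 * r + 1)%N by lia.
    by exists (Ordinal lt0); rewrite -(inj_eq val_inj).
  apply: (@mem_e_rootD _ W i j); apply: WP.
    by exists i, j, false, false; rewrite !scale1r.
  by exists i, j, false, true; rewrite scale1r expr1 scaleN1r.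
lia.
Qed.

Lemma index_E8 : of_type Delta typeE8 -> ib = 0%N.
Proof.
move=> [phi [inj rtE]]; have le : (\dim h <= 8)%N := rank_le_ambient inj rtE.
move: le; rewrite (@rank_index 8 phi (@rootE8 R) inj rtE 8); first by move=> ?; lia.
move=> l; exact: chamber_ok_cascade chamber_E8 (@rootE8_integral R).
Qed.

Lemma index_F4 : of_type Delta typeF4 -> ib = 0%N.
Proof.
move=> [phi [inj rtE]]; have le : (\dim h <= 4)%N := rank_le_ambient inj rtE.
move: le; rewrite (@rank_index 4 phi (@rootF4 R) inj rtE 4); first by move=> ?; lia.
move=> l; exact: chamber_ok_cascade chamber_F4 (@rootF4_integral R).
Qed.

Lemma rootE7_constraint v : rootE7 v ->
  dotp (e (inord 6) + e (inord 7)) v = 0 :> R.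
Proof. by move=> [_ v67]; rewrite dotpC dotpDr !dotp_delta v67 addNr. Qed.

Lemma index_E7 : of_type Delta typeE7 -> ib = 0%N.
Proof.
move=> [phi [inj rtE]].
have le : (\dim h + 1 <= 8)%N.
  apply: (rank_le_roots inj rtE (S := [:: e (inord 6) + e (inord 7)])).
    rewrite seq1_free; apply/eqP => /rowP/(_ (inord 6))/eqP.
    by rewrite !mxE -!(inj_eq val_inj) /= !inordK // addr0 oner_eq0.
  by move=> _ v /[1!inE] /eqP -> /rootE7_constraint.
move: le; rewrite (@rank_index 8 phi (@rootE7 R) inj rtE 7); first by move=> ?; lia.
move=> l; exact: chamber_ok_cascade chamber_E7 (@rootE7_integral R).
Qed.

Lemma index_G2 : of_type Delta typeG2 -> ib = 0%N.
Proof.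
move=> [phi [inj rtE]].
have le : (\dim h + 1 <= 3)%N.
  apply: (rank_le_roots inj rtE (S := [:: const_mx 1])).
    rewrite seq1_free; apply/eqP => /rowP/(_ ord0)/eqP.
    by rewrite !mxE oner_eq0.
  move=> _ _ /[1!inE] /eqP -> [[i [j [_ ->]]]|[i [j [k [s [_ ->]]]]]].
    by rewrite dotpBr !dotp_delta !mxE subrr.
  by rewrite dotpZr !dotpBr dotpZr !dotp_delta !mxE; ring.
move: le; rewrite (@rank_index 3 phi (@rootG2 R) inj rtE 2); first by move=> ?; lia.
move=> l; exact: chamber_ok_cascade chamber_G2 (@rootG2_integral R).
Qed.

(** The roots span the orthogonal of e_5 - e_6 and e_6 + e_7 (numbered from 0).
    Below 5, the roots e_i + e_j and e_i - e_j give the coordinate vectors; a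
    half-spin root then gives the last one modulo e_5 and e_6. *)
Lemma index_E6 : of_type Delta typeE6 -> ib = 2%N.
Proof.
move=> [phi [inj rtE]].
have rk : \dim h = (ib + 4)%N.
  apply: (@rank_index 8 phi (@rootE6 R) inj rtE 4) => l.
  exact: chamber_ok_cascade chamber_E6 (@rootE6_integral R).
have le : (\dim h + 2 <= 8)%N.
  apply: (rank_le_roots inj rtE
    (S := [:: e (inord 5) - e (inord 6); e (inord 6) + e (inord 7)])).
    rewrite free_cons seq1_free span_seq1; apply/andP; split.
      apply/vlineP => -[k /rowP/(_ (inord 5))/eqP].
      by rewrite !mxE -!(inj_eq val_inj) /= !inordK // !addr0 mulr0 subr0 oner_eq0.
    apply/eqP => /rowP/(_ (inord 6))/eqP.
    by rewrite !mxE -!(inj_eq val_inj) /= !inordK // addr0 oner_eq0.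
  move=> _ v /[!inE] /orP[]/eqP -> [v7 v56]; last exact: rootE7_constraint.
  by rewrite dotpC dotpBr !dotp_delta v56 subrr.
have ge : (8 <= \dim h + 2)%N.
  apply: (rank_ge_roots inj rtE (S := [:: e (inord 5); e (inord 6)])) => W WP WS.
  have W5 : e (inord 5) \in W by apply: WS; rewrite mem_head.
  have W6 : e (inord 6) \in W by apply: WS; rewrite inE mem_head orbT.
  have Wz z : z \in rootsE6z -> vec R 8 z \in W.
    by move=> zR; apply/WP/rootE6_integral; exists z; [exact: zR|].
  have Wlt5 (i : 'I_8) : (i < 5)%N -> e i \in W.
    pose j := if i == 0%N :> nat then 1%N else 0%N.
    have j8 : (j < 8)%N by rewrite /j; case: ifP.
    have ijz : all (fun i => let j := if i == 0%N :> nat then 1%N else 0%N in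
        (pairz 8 i j false false \in rootsE6z) &&
        (pairz 8 i j false true \in rootsE6z)) (iota 0 5) by vm_compute.
    move=> i5; have := allP ijz i; rewrite mem_iota => /(_ i5)/andP[].
    move=> /Wz/[1!(vec_pairz R i (Ordinal j8) false false)] Wp.
    move=> /Wz/[1!(vec_pairz R i (Ordinal j8) false true)] Wm.
    apply: (@mem_e_rootD _ W i (Ordinal j8)).
      by move: Wp; rewrite !scale1r.
    by move: Wm; rewrite scale1r expr1 scaleN1r.
  move=> i; have [/Wlt5//|i5] := ltnP i 5.
  have [i5E|i5N] := eqVneq (i : nat) 5.
    by rewrite (_ : i = inord 5) //; apply/val_inj; rewrite /= inordK.
  have [i6E|i6N] := eqVneq (i : nat) 6.
    by rewrite (_ : i = inord 6) //; apply/val_inj; rewrite /= inordK.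
  have i7 : i = inord 7.
    by apply/val_inj; rewrite /= inordK //; case: i i5 i5N i6N => /=; lia.
  pose z : seq int := [:: 1; 1; 1; 1; 1; -1; -1; 1].
  have zR : z \in rootsE6z by vm_compute.
  have zE := row_sum_delta (vec R 8 z); rewrite (bigD1 i) //= in zE.
  have zi : vec R 8 z 0 i != 0.
    by rewrite i7 vec_inord // mulf_neq0 ?invr_eq0 ?pnatr_eq0 ?intr_eq0.
  have : vec R 8 z 0 i *: e i \in W.
    rewrite -[X in X \in W](addrK (\sum_(k < 8 | k != i) vec R 8 z 0 k *: e k)) -zE.
    apply: memvB; first exact: Wz.
    apply: memv_suml => k ki; apply: memvZ; have [/Wlt5//|k5] := ltnP k 5.
    have [k5E|k5N] := eqVneq (k : nat) 5.
      by rewrite (_ : k = inord 5) //; apply/val_inj; rewrite /= inordK.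
    rewrite (_ : k = inord 6) //; apply/val_inj; rewrite /= inordK //.
    move: ki; rewrite i7 -(inj_eq val_inj) /= inordK //.
    by case: k k5 k5N => /=; lia.
  by move=> /(memvZ (vec R 8 z 0 i)^-1); rewrite scalerA mulVf // scale1r.
lia.
Qed.

End BorelIndex.

Theorem theorem5 (R : realType) (g : vectType R) (br : g -> g -> g)
  (h : {vspace g}) (Delta Delta_plus : seq (dual h))
  (g_lie : lie_bracket br) (g_simple : lie_simple br)
  (h_cartan : cartan_subalgebra br h)
  (Delta_roots : root_system br Delta)
  (g_split : split_wrt br Delta)
  (Delta_plus_pos : positive_system Delta Delta_plus) :
  let b := borel br Delta_plus in
  let ib := lie_index (@sub_bracket R g br b) in
  [/\ forall r : nat, of_type Delta (typeA r) -> ib = (r %/ 2)%N,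
      (forall r : nat,
         [\/ of_type Delta (typeB r), of_type Delta (typeC r)
           | of_type Delta (typeD (2 * r))] -> ib = 0%N) /\
      ([\/ of_type Delta typeE8, of_type Delta typeE7,
           of_type Delta typeF4 | of_type Delta typeG2] -> ib = 0%N),
      forall r : nat, of_type Delta (typeD (2 * r + 1)) -> ib = 1%N
    & of_type Delta typeE6 -> ib = 2%N].
Proof.
split.
- exact: index_A.
- split=> [r [D|D|D]|[D|D|D|D]].
  + exact: index_B D.
  + exact: index_C D.
  + exact: index_D_even D.
  + exact: index_E8 D.
  + exact: index_E7 D.
  + exact: index_F4 D.
  + exact: index_G2 D.
- exact: index_D_odd.
- exact: index_E6.
Qed.
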